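(* Let $K$ be an algebraically closed field of characteristic zero, let $\overline{\mathbb{Q}}\subseteq K$ be the algebraic closure of $\mathbb{Q}$ in $K$, and let $\mathbb{A}\subseteq\overline{\mathbb{Q}}$ be the ring of algebraic integers. Let $H$ be a semisimple Hopf algebra over $K$ of finite dimension $n$. If there is an algebraic number field $L\subseteq\overline{\mathbb{Q}}$ (a finite extension of $\mathbb{Q}$) such that $H$ admits a weak $(\mathbb{A}\cap L)$-form, then $H$ is of Frobenius type.
   Context: The Hopf algebra operations on $H$ are the multiplication $m$, unit $u$, comultiplication $\Delta$, counit $\varepsilon$ and antipode $S$; Sweedler notation $\Delta(h)=\sum_{(h)}h_1\otimes h_2$ is used. Let $\int_H$ be the space of integrals of $H$, i.e. elements $\Lambda\in H$ with $h\Lambda=\Lambda h=\varepsilon(h)\Lambda$ for all $h\in H$, and let $\Lambda\in\int_H$ be the integral normalized by $\varepsilon(\Lambda)=n=\dim_K H$. Define $\nu=\sum_{(\Lambda)}\Lambda_1\otimes S(\Lambda_2)\in H\otimes_K H$. Weak form: for a subring $R\subseteq K$, a weak $R$-form of $H$ is a free $R$-submodule $H_R\subseteq H$ with an $R$-basis $x_1,\dots,x_n$ that is also a $K$-basis of $H$, such that, writing $m(x_i\otimes x_j)=\sum_{l} m_{i,j}^{l}x_l$ and $\nu=\sum_{i,j}\nu^{i,j}x_i\otimes x_j$ with $m_{i,j}^l,\nu^{i,j}\in K$, all the coefficients $m_{i,j}^{l}$ and $\nu^{i,j}$ belong to $R$. Frobenius type: $H$ is of Frobenius type if the degree (the $K$-dimension)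 of every irreducible representation of $H$ divides $n=\dim_K H$. *)

(* Defs.v *)
From HB Require Import structures.
From mathcomp Require Import all_boot all_order all_algebra all_field.

Set Implicit Arguments.
Unset Strict Implicit.
Unset Printing Implicit Defensive.
Import GRing.Theory.
Local Open Scope ring_scope.

(* MathComp has no tensor product of vector spaces.  An element of U ⊗ V is   *)
(* stored as its coordinates on the products of the vectors of the library    *)
(* bases of U and V; the lemmas tensDl to tens_liftE establish the universal  *)
(* property, so nothing below depends on the chosen bases.  Row vectors are   *)
(* used rather than matrices, so that H ⊗ H does not inherit the product of   *)
(* square matrices.                                                           *)
Definition tens (K : fieldType) (U V : vectType K) : Type :=
  'rV[K]_(\dim {:U} * \dim {:V}).

HB.instance Definition _ (K : fieldType) (U V : vectType K) :=
  Vector.copy (tens U V) 'rV[K]_(\dim {:U} * \dim {:V}).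

Definition tensor (K : fieldType) (U V : vectType K) (u : U) (v : V) :
    tens U V :=
  mxvec (\matrix_(i, j) (coord (vbasis {:U}) i u * coord (vbasis {:V}) j v)).

Notation "U ⊗ V" := (tens U V) (at level 40, left associativity) : type_scope.
Notation "u ⊗ v" := (tensor u v) (at level 40, left associativity) : ring_scope.

(* For f bilinear, the linear map U ⊗ V -> W induced by f. *)
Definition tens_lift (K : fieldType) (U V W : vectType K) (f : U -> V -> W)
    (t : (U ⊗ V)%type) : W :=
  \sum_i \sum_j vec_mx t i j *: f (vbasis {:U})`_i (vbasis {:V})`_j.

Definition tens_map (K : fieldType) (U V U' V' : vectType K)
    (f : U -> U') (g : V -> V') : (U ⊗ V)%type -> (U' ⊗ V')%type :=
  tens_lift (fun u v => f u ⊗ g v).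

Definition tens_assoc (K : fieldType) (U V W : vectType K) :
    (U ⊗ (V ⊗ W))%type -> (U ⊗ V ⊗ W)%type :=
  tens_lift (fun u => tens_lift (fun v w => u ⊗ v ⊗ w)).

Definition tens_mul (K : fieldType) (A B : falgType K)
    (s t : (A ⊗ B)%type) : (A ⊗ B)%type :=
  tens_lift (fun a b => tens_lift (fun c d => (a * c) ⊗ (b * d)) t) s.

Section TensorTheory.
Variables (K : fieldType) (U V W : vectType K).

Lemma tensDl (u u' : U) (v : V) : (u + u') ⊗ v = u ⊗ v + u' ⊗ v.
Proof.
rewrite /tensor -linearD; congr mxvec.
by apply/matrixP=> i j; rewrite !mxE linearD mulrDl.
Qed.

Lemma tensDr (u : U) (v v' : V) : u ⊗ (v + v') = u ⊗ v + u ⊗ v'.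
Proof.
rewrite /tensor -linearD; congr mxvec.
by apply/matrixP=> i j; rewrite !mxE linearD mulrDr.
Qed.

Lemma tensZl a (u : U) (v : V) : (a *: u) ⊗ v = a *: (u ⊗ v).
Proof.
rewrite /tensor -linearZ; congr mxvec.
by apply/matrixP=> i j; rewrite !mxE linearZ mulrA.
Qed.

Lemma tensZr a (u : U) (v : V) : u ⊗ (a *: v) = a *: (u ⊗ v).
Proof.
rewrite /tensor -linearZ; congr mxvec.
by apply/matrixP=> i j; rewrite !mxE linearZ mulrCA.
Qed.

Lemma tens_lift_is_linear (f : U -> V -> W) : linear (tens_lift f).
Proof.
move=> a s t; rewrite /tens_lift scaler_sumr -big_split; apply: eq_bigr => i _.
rewrite scaler_sumr -big_split; apply: eq_bigr => j _ /=.
by rewrite linearP !mxE scalerDl scalerA.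
Qed.

HB.instance Definition _ (f : U -> V -> W) :=
  GRing.isLinear.Build K (U ⊗ V)%type W _ (tens_lift f) (tens_lift_is_linear f).

Lemma tens_decomp (t : (U ⊗ V)%type) :
  t = tens_lift (fun u v => u ⊗ v) t.
Proof.
have fr (T : vectType K) (k l : 'I_(\dim {:T})) :
    coord (vbasis {:T}) k (vbasis {:T})`_l = (k == l)%:R.
  by rewrite coord_free ?(basis_free (vbasisP _)) // eq_sym.
apply: (can_inj vec_mxK); rewrite {1}[vec_mx t]matrix_sum_delta linear_sum.
apply: eq_bigr => i _; rewrite linear_sum; apply: eq_bigr => j _.
rewrite linearZ /= mxvecK; congr (_ *: _); apply/matrixP=> k l.
by rewrite !mxE !fr -natrM mulnb.
Qed.

Lemma tens_liftE (f : U -> V -> W) (u : U) (v : V) :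
    (forall y, linear (f^~ y)) -> (forall x, linear (f x)) ->
  tens_lift f (u ⊗ v) = f u v.
Proof.
move=> fl fr.
have sl y (n : nat) (c : 'I_n -> K) (x : 'I_n -> U) :
    f (\sum_i c i *: x i) y = \sum_i c i *: f (x i) y.
  pose g := GRing.isLinear.Build K U W _ (f^~ y) (fl y).
  pose G : {linear U -> W} := HB.pack (f^~ y) g.
  rewrite -[LHS]/(G _) linear_sum; apply: eq_bigr => i _; exact: linearZ.
have sr x (n : nat) (c : 'I_n -> K) (y : 'I_n -> V) :
    f x (\sum_i c i *: y i) = \sum_i c i *: f x (y i).
  pose g := GRing.isLinear.Build K V W _ (f x) (fr x).
  pose G : {linear V -> W} := HB.pack (f x) g.
  rewrite -[LHS]/(G _) linear_sum; apply: eq_bigr => i _; exact: linearZ.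
rewrite {2}(coord_vbasis (memvf u)) sl; apply: eq_bigr => i _.
rewrite {2}(coord_vbasis (memvf v)) sr scaler_sumr; apply: eq_bigr => j _.
by rewrite mxvecK mxE scalerA.
Qed.

End TensorTheory.

Record hopf_structure (K : fieldType) (H : falgType K) := HopfStructure {
  comul : {linear H -> (H ⊗ H)%type};
  counit : {scalar H};
  antipode : {linear H -> H};
  comul1 : comul 1 = 1 ⊗ 1;
  comulM : forall a b, comul (a * b) = tens_mul (comul a) (comul b);
  counit1 : counit 1 = 1;
  counitM : forall a b, counit (a * b) = counit a * counit b;
  comulA : forall h,
    tens_map comul id (comul h) = tens_assoc (tens_map id comul (comul h));
  comul_counitl : forall h,
    tens_lift (fun a b => counit a *: b) (comul h) = h;
  comul_counitr : forall h,
    tens_lift (fun a b => counit b *: a) (comul h) = h;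
  antipodel : forall h,
    tens_lift (fun a b => antipode a * b) (comul h) = (counit h)%:A;
  antipoder : forall h,
    tens_lift (fun a b => a * antipode b) (comul h) = (counit h)%:A }.

Section Algebras.
Variables (K : fieldType) (H : falgType K).

Definition left_ideal (I : {vspace H}) : Prop :=
  forall h x : H, x \in I -> h * x \in I.

Definition semisimple_algebra : Prop :=
  forall I : {vspace H}, left_ideal I ->
  exists J : {vspace H},
    [/\ left_ideal J, (I + J)%VS = fullv & (I :&: J)%VS = 0%VS].

Definition is_representation (V : vectType K)
    (rho : {linear H -> 'End(V)}) : Prop :=
  rho 1 = \1%VF /\ forall a b : H, rho (a * b) = (rho a \o rho b)%VF.

Definition irreducible_representation (V : vectType K)
    (rho : {linear H -> 'End(V)}) : Prop :=
  [/\ is_representation rho, (0 < \dim {:V})%N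
    & forall U : {vspace V}, (forall h, (rho h @: U <= U)%VS) ->
      U = 0%VS \/ U = fullv].

(* Irreducible representations of a finite-dimensional algebra are finite     *)
(* dimensional, so quantifying over vectType loses none of them.              *)
Definition frobenius_type : Prop :=
  forall (V : vectType K) (rho : {linear H -> 'End(V)}),
    irreducible_representation rho -> (\dim {:V} %| \dim {:H})%N.

End Algebras.

(* A subring with a Prop-valued membership predicate: integrality is not      *)
(* decidable by a boolean predicate in the library.                           *)
Record subring (K : nzRingType) := Subring {
  in_subring :> K -> Prop;
  subring1 : in_subring 1;
  subringB : forall x y, in_subring x -> in_subring y -> in_subring (x - y);
  subringM : forall x y, in_subring x -> in_subring y -> in_subring (x * y) }.

Definition algebraic_integer (K : fieldType) (x : K) : Prop :=
  integralOver (intr : int -> K) x.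

Section NumberRing.
Variables (K : fieldType) (L : fieldExtType rat) (iota : {rmorphism L -> K}).

Definition in_number_ring (x : K) : Prop :=
  algebraic_integer x /\ exists l : L, iota l = x.

Lemma number_ring1 : in_number_ring 1.
Proof. by split; [exact: integral1 | exists 1; rewrite rmorph1]. Qed.

Lemma number_ringB x y :
  in_number_ring x -> in_number_ring y -> in_number_ring (x - y).
Proof.
move=> [ix [l Dx]] [iy [k Dy]]; split; first exact: (@integral_sub _ _ (intmul 1) _ _ ix iy).
by exists (l - k); rewrite rmorphB Dx Dy.
Qed.

Lemma number_ringM x y :
  in_number_ring x -> in_number_ring y -> in_number_ring (x * y).
Proof.
move=> [ix [l Dx]] [iy [k Dy]]; split; first exact: (@integral_mul _ _ (intmul 1) _ _ ix iy).
by exists (l * k); rewrite rmorphM Dx Dy.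
Qed.

(* The ring of algebraic integers of K lying in the number field iota(L). *)
Definition number_ring : subring K :=
  Subring number_ring1 number_ringB number_ringM.

(* The image of a number field automatically lies in the algebraic closure    *)
(* of the rationals in K.                                                     *)
Lemma number_field_algebraic (l : L) :
  algebraicOver (ratr : rat -> K) (iota l).
Proof.
have [q Dq] := polyOver1P (minPolyOver 1 l).
have nz_q : q != 0.
  rewrite -(map_poly_eq0 (in_alg L)) -Dq.
  by apply: monic_neq0; apply: monic_minPoly.
exists q => //; have := root_minPoly 1 l; rewrite Dq -(fmorph_root iota).
rewrite -map_poly_comp; congr (is_true (root _ _)); apply: eq_map_poly => a.
exact: (fmorph_eq_rat (iota \o in_alg L)).
Qed.

End NumberRing.

Section WeakForm.
Variables (K : fieldType) (H : falgType K) (S : hopf_structure H).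
Local Notation n := (\dim {:H}).

Definition integral (Lam : H) : Prop :=
  forall h : H, h * Lam = counit S h *: Lam /\ Lam * h = counit S h *: Lam.

Definition normalized_integral (Lam : H) : Prop :=
  integral Lam /\ counit S Lam = n%:R.

Definition nu (Lam : H) : (H ⊗ H)%type :=
  tens_map id (antipode S) (comul S Lam).

(* HR is a weak R-form of H: the R-span of a K-basis x of H on which the      *)
(* product and nu have their coefficients in R; x is then also an R-basis.    *)
(* When H is semisimple and K has characteristic 0, as in all uses, exactly   *)
(* one Lam is a normalized integral, and the quantifier on Lam only names it. *)
Definition weak_form (R : subring K) (HR : H -> Prop) : Prop :=
  exists x : n.-tuple H,
  [/\ basis_of {:H} x,
      forall h, HR h <->
        exists2 c : 'I_n -> K,
          forall i, R (c i) & h = \sum_i c i *: x`_i,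
      exists2 m : 'I_n -> 'I_n -> 'I_n -> K,
        forall i j l, R (m i j l)
        & forall i j : 'I_n, x`_i * x`_j = \sum_l m i j l *: x`_l
    & forall Lam, normalized_integral Lam ->
        exists2 nuc : 'I_n -> 'I_n -> K,
          forall i j, R (nuc i j)
          & nu Lam = \sum_i \sum_j nuc i j *: (x`_i ⊗ x`_j)].

End WeakForm.

(* Main.v *)
Require Import Defs.
From HB Require Import structures.
From mathcomp Require Import all_boot all_order all_algebra all_fingroup.
From mathcomp Require Import all_solvable all_field zify.

(** Let Lam be the integral of H with eps(Lam) = n, and let nu = Lam1 ⊗ S(Lam2) in
    Sweedler notation.  Since nu is a Casimir element
    (h Lam1 ⊗ S(Lam2) = Lam1 ⊗ S(Lam2) h), the sum of rho(Lam1) phi rho(S(Lam2))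
    commutes with an irreducible action rho on V for every endomorphism phi of V,
    hence is a scalar.  If S^2 = id, then S(Lam2) Lam1 = n, so comparing traces
    shows that this scalar is (n / dim V) tr phi (casimir_flip): in other words nu
    acts on V ⊗ V as n / dim V times the flip.  So n / dim V is an eigenvalue of
    the multiplication by nu on H ⊗ H, whose matrix in the basis of a weak form has
    algebraic integers as entries.  A rational algebraic integer is an integer,
    hence dim V divides n (frobenius_divisibility).

    The theorem of Larson and Radford that S^2 = id for a semisimple Hopf algebra
    in characteristic 0 (square_antipode) takes up most of the proof.

    - Integrals.  A complement of the kernel of the counit gives a left integral.
      From here on Lam is normalized by eps(Lam) = 1.  The form
      lam(h) = tr (x |-> S^2(x) h) is an integral of the dual algebra, and it is
      not zero because lam(Lam) = 1 (trace_form_rint, trace_form_integral).  The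
      dual bases that lam and Lam provide show that S is bijective, whence Lam is
      two-sided (unimodular).

    - Radford's formula.  One has lam(S^2(y) z) = lam(z y), whereas the form
      mu(h) = lam(gh) satisfies mu(y z) = mu(z S^2(y)), where g is the grouplike
      element defined by h1 lam(h2) = lam(h) g.  Comparing the two,
      S^4(z) = g z g^(-1) (radford).  Distinct grouplikes are linearly independent,
      so g, and therefore S^2, has finite order.

    - S^2 has nonzero trace.  The element v = S^2(Lam1) S(Lam2) implements S^2 as
      an inner automorphism (twist_elt_comm).  Decompose 1 into orthogonal
      primitive idempotents e_i fixed by S^2 (primitive_decomposition); then
      v e_i = w_i e_i, and e_i H e_j is either zero or a line on which S^2 is
      w_i / w_j, a root of unity.  Hence tr S^2 is a sum, over the classes of
      isomorphic simple modules H e_i, of squared moduli of sums of roots of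
      unity; it is compared with a sum in algC, because an integer polynomial
      relation between roots of unity of K can be transported there.  The class
      of the trivial module has one element and contributes 1, so the sum is not
      zero (sum_unity_roots_neq0, tr_inner_neq0).

    - S^2 = id.  As tr S^2 = lam(1) is not zero, evaluating at 1 the relation
      defining g gives g = 1, so S^4 = id and tr S^2 = n - 2m, where m is the
      dimension of the eigenspace of -1.  Let X in H be the character of the
      regular representation of the dual algebra: X^2 = nX, S^2(X) = X and
      lam(X) = lam(1).  Then B : y |-> S^2(y) X satisfies B^3 = n^2 B, so that
      tr B is n times an integer; and tr B = lam(X) = tr S^2.  So n divides
      n - 2m, which is not zero: m = 0 or m = n, and m = n is excluded because
      S^2(1) = 1. *)

Set Implicit Arguments.
Unset Strict Implicit.
Unset Printing Implicit Defensive.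
Import GRing.Theory.
Local Open Scope ring_scope.

(** * Linear functions and Sweedler sums *)

(** Linearity is kept as a property of plain functions: the functions below are
    terms with several free variables, and their linearity in one of them is
    proved on the spot by the tactic lin, which follows the shape of the term. *)
Section LinearFunctions.
Variables (K : fieldType) (U V W : lmodType K).

Lemma lin_sum (f : U -> V) I r (P : pred I) (F : I -> U) : linear f ->
  f (\sum_(i <- r | P i) F i) = \sum_(i <- r | P i) f (F i).
Proof.
move=> fl; pose g := GRing.isLinear.Build K U V _ f fl.
pose G : {linear U -> V} := HB.pack f g.
exact: (linear_sum G).
Qed.

Lemma linZ (f : U -> V) a x : linear f -> f (a *: x) = a *: f x.
Proof.
move=> fl; pose g := GRing.isLinear.Build K U V _ f fl.
pose G : {linear U -> V} := HB.pack f g.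
exact: (linearZ_LR G).
Qed.

Lemma lin_id : linear (fun x : U => x). Proof. by []. Qed.

Lemma lin_comp (phi : V -> W) (f : U -> V) : linear phi -> linear f ->
  linear (fun x => phi (f x)).
Proof. by move=> pl fl a x y; rewrite fl pl. Qed.

Lemma lin_compS (phi : V -> K) (f : U -> V) : scalar phi -> linear f ->
  scalar (fun x => phi (f x)).
Proof. by move=> pl fl a x y; rewrite fl pl. Qed.

Lemma lin_app (phi : {linear V -> W}) (f : U -> V) : linear f ->
  linear (fun x => phi (f x)).
Proof. by move=> fl a x y; rewrite fl linearP. Qed.

Lemma lin_scalar (phi : {scalar V}) (f : U -> V) : linear f ->
  scalar (fun x => phi (f x)).
Proof. by move=> fl a x y; rewrite fl linearP. Qed.

Lemma lin_scalel (f : U -> K) (v : V) : scalar f -> linear (fun x => f x *: v).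
Proof. by move=> fl a x y; rewrite fl scalerDl scalerA. Qed.

Lemma lin_scaler (f : U -> V) (c : K) : linear f -> linear (fun x => c *: f x).
Proof. by move=> fl a x y; rewrite fl scalerDr !scalerA mulrC. Qed.

Lemma lin_suml (I : finType) (F : I -> U -> V) :
  (forall i, linear (F i)) -> linear (fun x => \sum_i F i x).
Proof.
move=> Fl a x y; rewrite scaler_sumr -big_split; apply: eq_bigr => i _.
exact: Fl.
Qed.

End LinearFunctions.

Section BilinearFunctions.
Variables (K : fieldType) (U V W X : lmodType K) (h : U -> V -> W).

Lemma lin_app2l (f : X -> U) v : (forall y, linear (h^~ y)) -> linear f ->
  linear (fun x => h (f x) v).
Proof. by move=> hl fl a x y; rewrite fl hl. Qed.

Lemma lin_app2r (f : X -> V) u : (forall x, linear (h x)) -> linear f ->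
  linear (fun x => h u (f x)).
Proof. by move=> hl fl a x y; rewrite fl hl. Qed.

End BilinearFunctions.

Section AlgebraFunctions.
Variables (K : fieldType) (U : lmodType K) (A : algType K).

Lemma lin_mull (f : U -> A) c : linear f -> linear (fun x => f x * c).
Proof. by move=> fl a x y; rewrite fl mulrDl scalerAl. Qed.

Lemma lin_mulr (f : U -> A) c : linear f -> linear (fun x => c * f x).
Proof. by move=> fl a x y; rewrite fl mulrDr scalerAr. Qed.

Lemma lin_scal_mull (f : U -> K) c : scalar f -> scalar (fun x => f x * c).
Proof. by move=> fl a x y; rewrite fl mulrDl mulrA. Qed.

Lemma lin_scal_mulr (f : U -> K) c : scalar f -> scalar (fun x => c * f x).
Proof. by move=> fl a x y; rewrite fl mulrDr mulrCA. Qed.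

End AlgebraFunctions.

Section TensorFunctions.
Variables (K : fieldType) (U V : vectType K) (X : lmodType K).

Lemma lin_tensl (f : X -> U) (v : V) : linear f -> linear (fun x => f x ⊗ v).
Proof. by move=> fl a x y; rewrite fl tensDl tensZl. Qed.

Lemma lin_tensr (f : X -> V) (u : U) : linear f -> linear (fun x => u ⊗ f x).
Proof. by move=> fl a x y; rewrite fl tensDr tensZr. Qed.

Lemma lin_coord m (X0 : m.-tuple U) i (f : X -> U) : linear f ->
  scalar (fun x => coord X0 i (f x)).
Proof. by move=> fl a x y; rewrite fl linearP. Qed.

End TensorFunctions.

Section Sweedler.
Variables (K : fieldType) (H : falgType K) (S : hopf_structure H).
Local Notation b i := (vbasis {:H})`_i.

(** sweedler f h is the sum of f(h1, h2).  No bilinearity of f is imposed: it is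
    required only where a Hopf algebra axiom is used. *)
Definition sweedler (W : lmodType K) (f : H -> H -> W) (h : H) : W :=
  \sum_i \sum_j vec_mx (comul S h) i j *: f (b i) (b j).

Local Notation sw := sweedler.

Lemma swE (W : vectType K) (f : H -> H -> W) h :
  sw f h = tens_lift f (comul S h).
Proof. by []. Qed.

Lemma eq_sw (W : lmodType K) (f g : H -> H -> W) h :
  (forall x y, f x y = g x y) -> sw f h = sw g h.
Proof.
by move=> fg; apply: eq_bigr => i _; apply: eq_bigr => j _; rewrite fg.
Qed.

Lemma lin_sw (U W : lmodType K) (f : H -> H -> W) (g : U -> H) :
  linear g -> linear (fun x => sw f (g x)).
Proof.
move=> gl a x y; rewrite gl /sweedler scaler_sumr -big_split; apply: eq_bigr => i _.
rewrite scaler_sumr -big_split; apply: eq_bigr => j _ /=.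
by rewrite !linearP !mxE scalerDl scalerA.
Qed.

Lemma lin_sw_in (U W : lmodType K) (F : U -> H -> H -> W) h :
  (forall x y, linear (fun u => F u x y)) -> linear (fun u => sw (F u) h).
Proof.
move=> Fl; apply: lin_suml => // i; apply: lin_suml => // j.
exact: lin_scaler.
Qed.

Lemma sw_map (W X : lmodType K) (phi : W -> X) (f : H -> H -> W) h :
  linear phi -> phi (sw f h) = sw (fun x y => phi (f x y)) h.
Proof.
move=> pl; rewrite [LHS]lin_sum //; apply: eq_bigr => i _.
rewrite [LHS]lin_sum //; apply: eq_bigr => j _; exact: linZ.
Qed.

Lemma sw_sum (W : lmodType K) (I : Type) (r : seq I) (P : pred I)
    (F : I -> H -> H -> W) h :
  sw (fun x y => \sum_(i <- r | P i) F i x y) h =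
  \sum_(i <- r | P i) sw (F i) h.
Proof.
rewrite /sweedler [RHS]exchange_big; apply: eq_bigr => i _ /=.
rewrite [RHS]exchange_big; apply: eq_bigr => j _ /=.
by rewrite scaler_sumr.
Qed.

Lemma swZ (W : lmodType K) a (f : H -> H -> W) h :
  sw (fun x y => a *: f x y) h = a *: sw f h.
Proof. by rewrite [RHS]sw_map // => c u v; rewrite scalerDr !scalerA mulrC. Qed.

Lemma sw_comm (W : lmodType K) (F : H -> H -> H -> H -> W) h k :
  sw (fun x y => sw (fun z t => F x y z t) k) h =
  sw (fun z t => sw (fun x y => F x y z t) h) k.
Proof.
rewrite {2}/sweedler sw_sum; apply: eq_bigr => i _.
by rewrite sw_sum; apply: eq_bigr => j _; rewrite swZ.
Qed.

End Sweedler.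

Ltac lin := repeat match goal with |- forall _, _ => intro end;
  match goal with
  | |- linear (fun x => x) => exact: lin_id
  | |- linear (GRing.Linear.sort _) => exact: linearP
  | |- scalar (GRing.Linear.sort _) => exact: linearP
  | |- scalar (coord _ _) => exact: linearP
  | |- linear (GRing.mul _) => exact: (lin_mulr _ (@lin_id _ _))
  | |- linear (GRing.scale _) => exact: (lin_scaler _ (@lin_id _ _))
  | |- linear (tensor _) => exact: (lin_tensr _ (@lin_id _ _))
  | |- linear (sweedler _ _) => apply: (lin_sw _ _ (@lin_id _ _))
  | |- linear (fun x => sweedler _ _ _) => first
      [apply: lin_sw; lin | apply: lin_sw_in; lin]
  | |- linear (fun x => _ * _) => first
      [apply: lin_mull; lin | apply: lin_mulr; lin]
  | |- linear (fun x => _ ⊗ _) => first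
      [apply: lin_tensl; lin | apply: lin_tensr; lin]
  | |- linear (fun x => _ *: _) => first
      [apply: lin_scaler; lin | apply: lin_scalel; lin]
  | |- scalar (fun x => _ * _) => first
      [apply: lin_scal_mull; lin | apply: lin_scal_mulr; lin]
  | |- linear (fun x => GRing.Linear.sort _ _) => apply: lin_app; lin
  | |- scalar (fun x => GRing.Linear.sort _ _) => apply: lin_scalar; lin
  | |- scalar (fun x => coord _ _ _) => apply: lin_coord; lin
  | fl : linear ?f |- linear (fun x => ?f _) => apply: (lin_comp fl); lin
  | fl : scalar ?f |- scalar (fun x => ?f _) => apply: (lin_compS fl); lin
  | fl : forall y, linear (fun x => ?f x y) |- linear (fun x => ?f _ _) =>
      apply: (lin_app2l _ fl); lin
  | fr : forall x, linear (?f x) |- linear (fun x => ?f _ _) =>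
      apply: (lin_app2r _ fr); lin
  | H : linear ?f |- linear ?f => exact: H
  | H : scalar ?f |- scalar ?f => exact: H
  | H : forall x, _ |- _ => exact: H
  end.

Section HopfIdentities.
Variables (K : fieldType) (H : falgType K) (S : hopf_structure H).
Local Notation sw := (sweedler S).
Local Notation eps := (counit S).
Local Notation sS := (antipode S).

Lemma lift_comp (U V W X : vectType K) (f : U -> V -> W) (g : W -> X) t :
  linear g -> g (tens_lift f t) = tens_lift (fun u v => g (f u v)) t.
Proof.
move=> gl; rewrite [LHS]lin_sum //; apply: eq_bigr => i _.
rewrite [LHS]lin_sum //; apply: eq_bigr => j _; exact: linZ.
Qed.

Lemma lift_ext (U V W : vectType K) (f g : U -> V -> W) t :
  (forall u v, f u v = g u v) -> tens_lift f t = tens_lift g t.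
Proof.
by move=> fg; apply: eq_bigr => i _; apply: eq_bigr => j _; rewrite fg.
Qed.

Lemma lin_lift_in (U V W : vectType K) (X : lmodType K)
    (F : X -> U -> V -> W) t :
  (forall x y, linear (fun u => F u x y)) ->
  linear (fun u => tens_lift (F u) t).
Proof.
move=> Fl; apply: lin_suml => // i; apply: lin_suml => // j.
exact: lin_scaler.
Qed.

(** Coassociativity: both sides are the sum of f(h1, h2, h3). *)
Lemma sw_assoc (W : vectType K) (f : H -> H -> H -> W) h :
    (forall y z, linear (fun x => f x y z)) ->
    (forall x z, linear (fun y => f x y z)) ->
    (forall x y, linear (fun z => f x y z)) ->
  sw (fun x z => sw (fun x y => f x y z) x) h =
  sw (fun x y => sw (fun y z => f x y z) y) h.
Proof.
move=> f1 f2 f3.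
pose F : (H ⊗ H ⊗ H)%type -> W :=
  tens_lift (fun t z => tens_lift (fun x y => f x y z) t).
have FE t z : F (t ⊗ z) = tens_lift (fun x y => f x y z) t.
  rewrite [LHS]tens_liftE //; first by move=> y; exact: tens_lift_is_linear.
  by move=> x; apply: lin_lift_in.
have Fl : linear F by exact: tens_lift_is_linear.
have := congr1 F (comulA S h); rewrite /tens_map /tens_assoc lift_comp //.
rewrite [in tens_lift _ (tens_lift _ _)]lift_comp; last first.
  exact: tens_lift_is_linear.
rewrite lift_comp // => E.
transitivity (tens_lift (fun u v : H => F (comul S u ⊗ id v)) (comul S h)).
  by apply: lift_ext => x z; rewrite FE.
rewrite E; apply: lift_ext => x t.
rewrite tens_liftE; last first.
- by move=> u; exact: tens_lift_is_linear.
- by move=> t1; apply: lin_lift_in => v w; lin.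
rewrite lift_comp //; apply: lift_ext => y z.
by rewrite FE tens_liftE.
Qed.

Lemma sw_mul (W : vectType K) (f : H -> H -> W) x y :
    (forall y, linear (fun x => f x y)) -> (forall x, linear (f x)) ->
  sw f (x * y) =
  sw (fun x1 x2 => sw (fun y1 y2 => f (x1 * y1) (x2 * y2)) y) x.
Proof.
move=> f1 f2; rewrite swE comulM /tens_mul lift_comp; last exact: tens_lift_is_linear.
apply: lift_ext => a c; rewrite lift_comp; last exact: tens_lift_is_linear.
by apply: lift_ext => a' c'; rewrite tens_liftE.
Qed.

Lemma sw1 (W : vectType K) (f : H -> H -> W) :
    (forall y, linear (fun x => f x y)) -> (forall x, linear (f x)) ->
  sw f 1 = f 1 1.
Proof. by move=> f1 f2; rewrite swE comul1 tens_liftE. Qed.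

Lemma sw_epsl (W : lmodType K) (f : H -> W) h : linear f ->
  sw (fun x y => eps x *: f y) h = f h.
Proof.
move=> fl; rewrite -[in RHS](comul_counitl S h) -swE sw_map //.
by apply: eq_sw => x y; rewrite linZ.
Qed.

Lemma sw_epsr (W : lmodType K) (f : H -> W) h : linear f ->
  sw (fun x y => eps y *: f x) h = f h.
Proof.
move=> fl; rewrite -[in RHS](comul_counitr S h) -swE sw_map //.
by apply: eq_sw => x y; rewrite linZ.
Qed.

Lemma sw_antil (W : lmodType K) (f : H -> W) h : linear f ->
  sw (fun x y => f (sS x * y)) h = eps h *: f 1.
Proof. by move=> fl; rewrite -linZ // -(antipodel S h) -swE sw_map. Qed.

Lemma sw_antir (W : lmodType K) (f : H -> W) h : linear f ->
  sw (fun x y => f (x * sS y)) h = eps h *: f 1.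
Proof. by move=> fl; rewrite -linZ // -(antipoder S h) -swE sw_map. Qed.

End HopfIdentities.

(** * The antipode and its square *)

Section Antipode.
Variables (K : fieldType) (H : falgType K) (S : hopf_structure H).
Local Notation sw := (sweedler S).
Local Notation eps := (counit S).
Local Notation sS := (antipode S).

Lemma anti1 : sS 1 = 1.
Proof.
have := antipodel S 1; rewrite counit1 scale1r -swE sw1; last by lin.
  by rewrite mulr1.
by lin.
Qed.

Lemma eps_anti h : eps (sS h) = eps h.
Proof.
have := congr1 eps (antipodel S h); rewrite linearZ /= counit1 mulr1 => <-.
rewrite -swE (@sw_map _ _ S _ _ (eps : H -> K^o)); last exact: linearP.
rewrite -[LHS](sw_epsr S (f := (fun x => eps (sS x)) : H -> K^o)); last first.
  by apply: lin_scalar; lin.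
by apply: (@eq_sw _ _ S K^o) => x y; rewrite counitM mulrC.
Qed.

(** The usual uniqueness of convolution inverses: both sides equal the sum of
    S(x1 y1) x2 y2 S(y3) S(x3). *)
Lemma antiM x y : sS (x * y) = sS y * sS x.
Proof.
transitivity (sw (fun x1 x2 => sw (fun y1 y2 =>
    sw (fun p q => sS p * q * (sS y2 * sS x2)) (x1 * y1)) y) x); last first.
  transitivity (sw (fun x1 x2 => eps x1 *: (sS y * sS x2)) x); last first.
    by rewrite sw_epsl //; lin.
  apply: eq_sw => x1 x2.
  transitivity (sw (fun y1 y2 => eps y1 *: (eps x1 *: (sS y2 * sS x2))) y).
    apply: eq_sw => y1 y2.
    rewrite (sw_antil S (f := fun z => z * (sS y2 * sS x2))); last by lin.
    by rewrite mul1r counitM mulrC scalerA.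
  by rewrite sw_epsl //; lin.
transitivity (sw (fun x1 x2 => sw (fun y1 y2 => sw (fun p1 p2 =>
   sw (fun q1 q2 => sS (p1 * q1) * (p2 * q2) * (sS y2 * sS x2)) y1) x1) y) x);
  last first.
  apply: eq_sw => x1 x2; apply: eq_sw => y1 y2.
  by rewrite sw_mul //; lin.
under eq_sw => x1 x2 do rewrite sw_comm.
rewrite (sw_assoc S (f := fun a b c => sw (fun y1 y2 =>
   sw (fun q1 q2 => sS (a * q1) * (b * q2) * (sS y2 * sS c)) y1) y)); try lin.
transitivity (sw (fun x1 x2 => sw (fun x2 x3 => sS (x1 * y) * x2 * sS x3) x2) x).
  under [RHS]eq_sw => x1 x2 do under eq_sw => x3 x4 do rewrite -mulrA.
  under [RHS]eq_sw => x1 x2 do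
    (rewrite (sw_antir S (f := fun z => sS (x1 * y) * z)); last by lin).
  by rewrite sw_epsr ?mulr1 //; lin.
apply: eq_sw => x1 x2; apply: eq_sw => x3 x4.
rewrite (sw_assoc S (f := fun a b c => sS (x1 * a) * (x3 * b) * (sS c * sS x4)));
  try lin.
transitivity (sw (fun y1 y2 => eps y2 *: (sS (x1 * y1) * x3 * sS x4)) y).
  by rewrite sw_epsr //; lin.
apply: eq_sw => y1 y2.
under eq_sw => a c do rewrite !mulrA -[_ * a * sS c]mulrA.
rewrite (sw_antir S (f := fun z => sS (x1 * y1) * x3 * z * sS x4)); last by lin.
by rewrite mulr1.
Qed.

(** S reverses the comultiplication.  Both sides equal the sum of
    f(p h2 S(h5), q h3 S(h4)), where p ⊗ q stands for the comultiplication of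
    S(h1). *)
Lemma sw_anti (W : vectType K) (f : H -> H -> W) h :
    (forall y, linear (fun x => f x y)) -> (forall x, linear (f x)) ->
  sw f (sS h) = sw (fun x y => f (sS y) (sS x)) h.
Proof.
move=> f1 f2.
pose G a u s := sw (fun y x => sw (fun p q => f (p * sS x) (q * sS y))
  (sS a * u)) s.
transitivity (sw (fun a r => sw (fun u s => G a u s) r) h); last first.
  rewrite -(sw_assoc S (f := G)) /G; try lin.
  transitivity (sw (fun c s => eps c *: sw (fun x y => f (sS y) (sS x)) s) h);
    last by rewrite sw_epsl //; lin.
  apply: eq_sw => c s.
  rewrite (sw_antil S (f := fun z => sw (fun y x =>
     sw (fun p q => f (p * sS x) (q * sS y)) z) s)); last by lin.
  congr (_ *: _); apply: eq_sw => y x; rewrite sw1 ?mul1r //; lin.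
transitivity (sw (fun a r => eps r *: sw f (sS a)) h).
  by rewrite sw_epsr //; lin.
apply: eq_sw => a r; rewrite -swZ.
transitivity (sw (fun p q => sw (fun u s => sw (fun y x => sw (fun u1 u2 =>
   f (p * u1 * sS x) (q * u2 * sS y)) u) s) r) (sS a)); last first.
  rewrite sw_comm; apply: eq_sw => u s; rewrite sw_comm; apply: eq_sw => y x.
  by rewrite [RHS]sw_mul //; lin.
apply: eq_sw => p q.
under [RHS]eq_sw => u s do rewrite sw_comm.
rewrite (sw_assoc S (f := fun u1 u2 s => sw (fun y x =>
  f (p * u1 * sS x) (q * u2 * sS y)) s)); try lin.
transitivity (sw (fun u1 t => f (p * (u1 * sS t)) q) r).
  by rewrite (sw_antir S (f := fun z => f (p * z) q)) ?mulr1 //; lin.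
apply: eq_sw => u1 t.
rewrite -(sw_assoc S (f := fun u2 y x => f (p * u1 * sS x) (q * u2 * sS y)));
  try lin.
transitivity (sw (fun c x => eps c *: f (p * u1 * sS x) q) t).
  by rewrite sw_epsl ?mulrA //; lin.
apply: eq_sw => c x.
under eq_sw => u2 y do rewrite -[q * _ * _]mulrA.
by rewrite (sw_antir S (f := fun z => f (p * u1 * sS x) (q * z))) ?mulr1 //; lin.
Qed.

Definition antipode2 : {linear H -> H} := sS \o sS.
Local Notation sg := antipode2.

Lemma antipode2E h : sg h = sS (sS h). Proof. by []. Qed.

Lemma antipode2M x y : sg (x * y) = sg x * sg y.
Proof. by rewrite !antipode2E !antiM. Qed.

Lemma antipode2_1 : sg 1 = 1. Proof. by rewrite !antipode2E !anti1. Qed.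

Lemma eps_antipode2 x : eps (sg x) = eps x. Proof. by rewrite !antipode2E !eps_anti. Qed.

Lemma sw_antipode2 (W : vectType K) (f : H -> H -> W) h :
    (forall y, linear (fun x => f x y)) -> (forall x, linear (f x)) ->
  sw f (sg h) = sw (fun x y => f (sg x) (sg y)) h.
Proof. by move=> f1 f2; rewrite !antipode2E !sw_anti //; lin. Qed.

End Antipode.

(** * Traces of linear functions *)

Section Trace.
Variables (K : fieldType) (V : vectType K).
Local Notation b i := (vbasis {:V})`_i.
Local Notation c i := (coord (vbasis {:V}) i).
Local Notation n := (\dim {:V}).

(** Functions are not required to be linear, so that tr applies to any lambda
    term. *)
Definition tr (F : V -> V) : K := \sum_i c i (F (b i)).

Lemma coord_b (i j : 'I_n) : c i (b j) = (i == j)%:R.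
Proof. by rewrite coord_free ?(basis_free (vbasisP _)) // eq_sym. Qed.

Lemma basis_sum x : x = \sum_i c i x *: b i.
Proof. exact: coord_vbasis (memvf x). Qed.

Lemma eq_tr F G : F =1 G -> tr F = tr G.
Proof. by move=> FG; apply: eq_bigr => i _; rewrite FG. Qed.

Lemma trC F G : linear F -> linear G ->
  tr (fun x => F (G x)) = tr (fun x => G (F x)).
Proof.
move=> Fl Gl; rewrite /tr.
have E (A B : V -> V) : linear A -> \sum_(i < n) c i (A (B (b i))) =
    \sum_(i < n) \sum_(k < n) c k (B (b i)) * c i (A (b k)).
  move=> Al; apply: eq_bigr => i _; rewrite {1}(basis_sum (B (b i))).
  rewrite lin_sum // linear_sum; apply: eq_bigr => k _.
  by rewrite linZ // linearZ.
rewrite [LHS](E F G) // [RHS](E G F) // exchange_big.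
apply: eq_bigr => k _; apply: eq_bigr => i _.
exact: mulrC.
Qed.

Lemma tr_rank1 (phi : V -> K) z : scalar phi -> tr (fun x => phi x *: z) = phi z.
Proof.
move=> pl; rewrite [in RHS](basis_sum z) (@lin_sum _ _ K^o) //.
apply: eq_bigr => i _; rewrite linearZ (@linZ _ _ K^o) //; exact: mulrC.
Qed.

Lemma tr_sum (I : finType) (P : pred I) (F : I -> V -> V) :
  tr (fun x => \sum_(i | P i) F i x) = \sum_(i | P i) tr (F i).
Proof.
rewrite /tr exchange_big; apply: eq_bigr => i _.
by rewrite linear_sum.
Qed.

Lemma trZ a F : tr (fun x => a *: F x) = a * tr F.
Proof. by rewrite /tr mulr_sumr; apply: eq_bigr => i _; rewrite linearZ. Qed.

Lemma trB F G : tr (fun x => F x - G x) = tr F - tr G.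
Proof. by rewrite /tr -sumrB; apply: eq_bigr => i _; rewrite linearB. Qed.

Lemma tr_id : tr id = n%:R.
Proof.
rewrite /tr (eq_bigr (fun=> 1)) ?sumr_const ?card_ord // => i _.
by rewrite coord_b eqxx.
Qed.

(** In a full rank factorization P = C R, idempotence forces R C = 1. *)
Lemma mxtrace_idem m (P : 'M[K]_m) : P *m P = P -> \tr P = (\rank P)%:R.
Proof.
move: (mulmx_base P) (col_base_full P) (row_base_free P).
move: (col_base P) (row_base P) => C R; move: (\rank P) C R => r C R PE Cf Rf PP.
have E : R *m C = 1%:M.
  apply: (row_full_inj Cf); apply: (row_free_inj Rf).
  by rewrite /= mulmx1 !mulmxA PE -mulmxA PE.
by rewrite -PE mxtrace_mulC E mxtrace1.
Qed.

(** The trace of a projection counts dimensions; the two extreme ranks are what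
    later turns an equality of traces into an equality of maps. *)
Lemma tr_idem F : linear F -> (forall x, F (F x) = F x) ->
  exists2 r : nat, tr F = r%:R &
    [/\ (r <= n)%N, (r = 0)%N -> forall x, F x = 0 & r = n -> forall x, F x = x].
Proof.
move=> Fl FF; pose M := \matrix_(i < n, j < n) c j (F (b i)).
have FM x : F x = \sum_j ((\row_i c i x) *m M) 0 j *: b j.
  rewrite {1}(basis_sum x) lin_sum //.
  rewrite (eq_bigr (fun i => \sum_j (c i x * c j (F (b i))) *: b j)).
    rewrite exchange_big; apply: eq_bigr => j _ /=.
    rewrite !mxE scaler_suml; apply: eq_bigr => i _.
    by rewrite !mxE.
  move=> i _; rewrite linZ // {1}(basis_sum (F (b i))) scaler_sumr.
  by apply: eq_bigr => j _; rewrite scalerA.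
have MM : M *m M = M.
  apply/matrixP=> i j; rewrite !mxE -[in RHS]FF.
  rewrite (basis_sum (F (b i))) lin_sum // linear_sum.
  by apply: eq_bigr => k _; rewrite !mxE linZ // linearZ.
exists (\rank M); first by rewrite -mxtrace_idem //; apply: eq_bigr => i _; rewrite mxE.
split; first exact: rank_leq_row.
  move=> /eqP; rewrite mxrank_eq0 => /eqP M0 x.
  by rewrite FM M0 mulmx0 big1 // => j _; rewrite mxE scale0r.
move=> Mn x; have M1 : M = 1%:M.
  have fM : row_free M by rewrite /row_free Mn.
  by apply: (row_free_inj fM); rewrite /= mul1mx.
by rewrite FM M1 mulmx1 [RHS]basis_sum; apply: eq_bigr => j _; rewrite mxE.
Qed.

End Trace.

(** * Semisimplicity, and the integral given by a trace *)

Section Semisimple.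
Variables (K : fieldType) (H : falgType K) (ssH : semisimple_algebra H).

(** Writing 1 = e + f along a complement J of I, every x in I satisfies
    x - x e = x f, which lies both in I and in J. *)
Lemma left_ideal_unit (I : {vspace H}) : left_ideal I ->
  exists2 e, e \in I & forall x, x \in I -> x * e = x.
Proof.
move=> lI; have [J [lJ IJ1 IJ0]] := ssH lI.
have /memv_addP[e Ie [f Jf D1]] : 1 \in (I + J)%VS by rewrite IJ1 memvf.
exists e => // x Ix; apply/eqP; rewrite -subr_eq0 -memv0 -IJ0 memv_cap.
rewrite memvB ?lI //= -{2}[x]mulr1 D1 mulrDr opprD addrA subrr add0r memvN.
exact: lJ.
Qed.

Lemma left_ideal_mulr (z : H) : left_ideal (limg (amulr z) : {vspace H}).
Proof.
move=> h x /memv_imgP[y _ ->]; rewrite lfunE /= mulrA.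
by apply/memv_imgP; exists (h * y); rewrite ?memvf // lfunE.
Qed.

Lemma von_neumann_regular (x : H) : exists h, x * h * x = x.
Proof.
have [e /memv_imgP[h _ De] xe] := left_ideal_unit (@left_ideal_mulr x).
exists h; rewrite -mulrA -[h * x](_ : e = _); last by rewrite De lfunE.
by apply: xe; apply/memv_imgP; exists 1; rewrite ?memvf // lfunE /= mul1r.
Qed.

End Semisimple.

Section Integral.
Variables (K : fieldType) (H : falgType K) (S : hopf_structure H).
Hypothesis ssH : semisimple_algebra H.
Local Notation eps := (counit S).
Local Notation sS := (antipode S).

(** A complement of the kernel of the counit is a line spanned by an integral. *)
Lemma left_integral1 : exists2 f, eps f = 1 & forall h, h * f = eps h *: f.
Proof.
pose phi : {linear H -> K^o} := HB.pack (eps : H -> K^o)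
  (GRing.isLinear.Build K H K^o _ (eps : H -> K^o) (linearP eps)).
pose I := lker (linfun phi).
have inI x : (x \in I) = (eps x == 0) by rewrite memv_ker lfunE.
have [|e] := @left_ideal_unit _ _ ssH I.
  by move=> h x; rewrite !inI counitM => /eqP->; rewrite mulr0.
rewrite inI => /eqP e0 Ie; exists (1 - e); first by rewrite linearB counit1 /= e0 subr0.
move=> h; have /Ie : h - eps h *: 1 \in I.
  by rewrite inI linearB linearZ /= counit1 mulr1 subrr.
rewrite mulrBl -scalerAl mul1r => E.
rewrite mulrBr mulr1 scalerBr -(subrK (eps h *: e) (h * e)) E.
by rewrite opprD opprB addrA [h + _]addrC subrK.
Qed.

End Integral.

Section TraceIntegral.
Variables (K : fieldType) (H : falgType K) (S : hopf_structure H).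
Local Notation eps := (counit S).
Local Notation sS := (antipode S).
Local Notation sw := (sweedler S).
Local Notation sg := (antipode2 S).
Local Notation b i := (vbasis {:H})`_i.
Local Notation c i := (coord (vbasis {:H}) i).
Local Notation n := (\dim {:H}).

Lemma resum (W : lmodType K) (f : H -> W) p : linear f ->
  \sum_(i < n) c i p *: f (b i) = f p.
Proof.
move=> fl; rewrite [in RHS](basis_sum p) lin_sum //.
by apply: eq_bigr => i _; rewrite linZ.
Qed.

(** Cyclicity of the trace applied to the coaction: moving the comultiplication
    of F x1 to the other end of the trace turns the sum of
    e^i(F(x1)_1) S(x2) F(x1)_2 over x = e_i into that of
    e^k(F x1) S(x2) x3 over x = e_k, and S(x2) x3 cancels. *)
Lemma trace_coaction (F : H -> H) : linear F ->
  \sum_(i < n) sw (fun x1 x2 => sw (fun p q => c i p *: (sS x2 * q)) (F x1)) (b i)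
  = (tr F)%:A.
Proof.
move=> Fl.
pose L i k := sw (fun x1 x2 => sw (fun p q =>
  c k (F x1) *: (c i p *: (sS x2 * q))) (b k)) (b i).
transitivity (\sum_(i < n) \sum_(k < n) L i k).
  apply: eq_bigr => i _; rewrite -sw_sum; apply: eq_sw => x1 x2.
  rewrite -(resum (f := sw (fun p q => c i p *: (sS x2 * q)))); last by lin.
  by apply: eq_bigr => k _; rewrite swZ.
rewrite exchange_big scaler_suml; apply: eq_bigr => k _ /=.
transitivity (sw (fun p q => sw (fun x1 x2 => c k (F x1) *: (sS x2 * q)) p) (b k)).
  rewrite /L (eq_bigr _ (fun i _ => sw_comm S _ _ _)) -sw_sum.
  apply: eq_sw => p q.
  rewrite -(resum (f := sw (fun x1 x2 => c k (F x1) *: (sS x2 * q)))); last by lin.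
  apply: eq_bigr => i _; rewrite -swZ; apply: eq_sw => x1 x2.
  by rewrite !scalerA mulrC.
rewrite (sw_assoc S (f := fun x1 x2 q => c k (F x1) *: (sS x2 * q))); try lin.
transitivity (sw (fun x1 t => eps t *: (c k (F x1) *: (1 : H))) (b k)); last first.
  by rewrite sw_epsr //; lin.
apply: eq_sw => x1 t.
by rewrite (sw_antil S (f := fun z => c k (F x1) *: z)) //; lin.
Qed.

(** The twist by S^2 is what makes this form an integral of the dual algebra. *)
Definition trace_form (h : H) : K := tr (fun x => sg x * h).

Lemma trace_form_scalar : scalar trace_form.
Proof.
move=> a x y; rewrite /trace_form /tr mulr_sumr -big_split; apply: eq_bigr => i _ /=.
by rewrite mulrDr linearD /= -scalerAr linearZ.
Qed.

HB.instance Definition _ :=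
  GRing.isLinear.Build K H K *%R trace_form trace_form_scalar.

(** With F(x) = S^2(x) h, the terms of trace_coaction are
    S(x3) S^2(x2) h2 = S(S(x2) x3) h2, which reduce to h2; without the square the
    two antipodes would not cancel. *)
Lemma trace_form_rint h : sw (fun x y => trace_form x *: y) h = (trace_form h)%:A.
Proof.
rewrite {2}/trace_form -trace_coaction; last by lin.
under eq_sw => x y do rewrite /trace_form /tr scaler_suml.
rewrite sw_sum; apply: eq_bigr => i _.
transitivity (sw (fun x1 x2 => sw (fun u w => sw (fun h1 h2 =>
  c i (sg u * h1) *: (sS x2 * (sg w * h2))) h) x1) (b i)); last first.
  apply: eq_sw => x1 x2; rewrite [RHS]sw_mul; try lin.
  by rewrite [RHS]sw_antipode2 //; lin.
rewrite (sw_assoc S (f := fun u w x2 => sw (fun h1 h2 =>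
  c i (sg u * h1) *: (sS x2 * (sg w * h2))) h)); try lin.
transitivity (sw (fun u t => eps t *: sw (fun h1 h2 =>
  c i (sg u * h1) *: h2) h) (b i)).
  by rewrite sw_epsr //; lin.
apply: eq_sw => u t.
transitivity (sw (fun w x2 => sw (fun h1 h2 =>
  c i (sg u * h1) *: (sS (sS w * x2) * h2)) h) t).
  rewrite (sw_antil S (f := fun z => sw (fun h1 h2 =>
    c i (sg u * h1) *: (sS z * h2)) h)); last by lin.
  by congr (_ *: _); apply: eq_sw => h1 h2; rewrite anti1 mul1r.
by apply: eq_sw => w x2; apply: eq_sw => h1 h2; rewrite antiM mulrA.
Qed.

(** Here x |-> S^2(x) Lam = eps(x) Lam has rank one. *)
Lemma trace_form_integral Lam : (forall h, h * Lam = eps h *: Lam) ->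
  trace_form Lam = eps Lam.
Proof.
move=> lL; rewrite /trace_form (eq_tr (G := fun x => eps (sg x) *: Lam)) //.
by rewrite tr_rank1 ?eps_antipode2 //; lin.
Qed.

Lemma trace_form1 : trace_form 1 = tr sg.
Proof. by apply: eq_tr => x; rewrite mulr1. Qed.

End TraceIntegral.

(** * Casimir elements and the bijectivity of the antipode *)

Section LeftIntegral.
Variables (K : fieldType) (H : falgType K) (S : hopf_structure H).
Local Notation eps := (counit S).
Local Notation sS := (antipode S).
Local Notation sw := (sweedler S).
Local Notation sg := (antipode2 S).
Variables (Lam : H) (lL : forall h, h * Lam = eps h *: Lam).

(** h Lam1 ⊗ S(Lam2) = Lam1 ⊗ S(Lam2) h: expand both sides from
    h1 Lam1 ⊗ S(h2 Lam2) h3. *)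
Lemma casimir (W : vectType K) (f : H -> H -> W) h :
    (forall y, linear (fun x => f x y)) -> (forall x, linear (f x)) ->
  sw (fun x y => f (h * x) (sS y)) Lam = sw (fun x y => f x (sS y * h)) Lam.
Proof.
move=> f1 f2.
(* a ⊗ c ⊗ t runs through h1 ⊗ h2 ⊗ h3. *)
pose G a c t := sw (fun x y => f (a * x) (sS (c * y) * t)) Lam.
transitivity (sw (fun a t => sw (fun c t => G a c t) t) h).
  transitivity (sw (fun a t => eps t *: sw (fun x y => f (a * x) (sS y)) Lam) h).
    by rewrite sw_epsr //; lin.
  apply: eq_sw => a t; rewrite /G sw_comm -swZ; apply: eq_sw => x y.
  transitivity (sw (fun c t => f (a * x) (sS y * (sS c * t))) t).
    by rewrite (sw_antil S (f := fun z => f (a * x) (sS y * z))) ?mulr1 //; lin.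
  by apply: eq_sw => c t'; rewrite antiM mulrA.
rewrite -(sw_assoc S (f := G)) /G; try lin.
transitivity (sw (fun x t => eps x *: sw (fun x y => f x (sS y * t)) Lam) h).
  apply: eq_sw => x t.
  transitivity (sw (fun x y => f x (sS y * t)) (x * Lam)).
    by rewrite [RHS]sw_mul //; lin.
  by rewrite lL linZ //; lin.
by rewrite sw_epsl //; lin.
Qed.

(** From here on lam is an integral of the dual algebra that satisfies
    lam(h1) h2 = lam(h), normalized by lam(Lam) = 1. *)
Variables (lam : {scalar H}).
Hypothesis lamR : forall h, sw (fun x y => lam x *: y) h = (lam h)%:A.
Hypothesis lamL : lam Lam = 1.

(** The Casimir element and lam are dual to each other, which makes H a Frobenius
    algebra. *)
Lemma dual_basis y : sw (fun a c => lam (y * a) *: sS c) Lam = y.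
Proof.
rewrite (casimir (f := fun a c => lam a *: c)); try lin.
transitivity (sS (sw (fun a c => lam a *: c) Lam) * y).
  rewrite (@sw_map _ _ S _ _ (fun z => sS z * y)); last by lin.
  by apply: eq_sw => a c; rewrite linearZ /= scalerAl.
by rewrite lamR lamL scale1r anti1 mul1r.
Qed.

Lemma anti_surj y : sS (sw (fun a c => lam (y * a) *: c) Lam) = y.
Proof.
rewrite -[RHS]dual_basis sw_map; last by lin.
by apply: eq_sw => a c; rewrite linearZ.
Qed.

Lemma anti_inj : injective sS.
Proof.
pose f : 'End(H) := linfun sS.
have fE x : f x = sS x by rewrite lfunE.
have /eqP: \dim (limg f) = \dim {:H}.
  congr (\dim _); apply/eqP; rewrite eqEsubv subvf /=.
  apply/subvP => y _; apply/memv_imgP.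
  exists (sw (fun a c => lam (y * a) *: c) Lam); first exact: memvf.
  by rewrite fE anti_surj.
rewrite -(limg_ker_dim f fullv) capfv -[X in X == _]add0n eqn_add2r.
rewrite eq_sym dimv_eq0 => /lker0P fI x y.
by rewrite -!fE => /fI.
Qed.

(** Traces computed in the dual bases given by lam and the Casimir element. *)
Lemma trace_casimir F : linear F ->
  tr F = sw (fun a c => (lam (F (sS c) * a) : K^o)) Lam.
Proof.
move=> Fl; rewrite -[LHS]/(\sum_i _).
transitivity (tr (fun x => \sum_i \sum_j vec_mx (comul S Lam) i j *:
    (lam (F x * (vbasis {:H})`_i) *: sS (vbasis {:H})`_j))).
  by apply: eq_tr => x; rewrite -{1}(dual_basis (F x)).
rewrite tr_sum; apply: eq_bigr => i _; rewrite tr_sum; apply: eq_bigr => j _.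
by rewrite trZ tr_rank1 //; lin.
Qed.

(** lam(x1 y) x2 = lam(x1 y1) x2 y2 S(y3) = lam(x y1) S(y2). *)
Lemma rint_mull x y : sw (fun p q => lam (p * y) *: q) x =
  sw (fun p q => lam (x * p) *: sS q) y.
Proof.
transitivity (sw (fun p q => sw (fun y1 y2 => eps y2 *: (lam (p * y1) *: q)) y) x).
  by apply: eq_sw => p q; rewrite sw_epsr //; lin.
transitivity (sw (fun p q => sw (fun y1 t => sw (fun y2 y3 =>
    lam (p * y1) *: (q * (y2 * sS y3))) t) y) x).
  apply: eq_sw => p q; apply: eq_sw => y1 y2.
  by rewrite (sw_antir S (f := fun z => lam (p * y1) *: (q * z))) ?mulr1 //; lin.
rewrite sw_comm.
transitivity (sw (fun y1 t => sw (fun y2 y3 => sw (fun p q =>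
    lam (p * y1) *: (q * (y2 * sS y3))) x) t) y).
  by apply: eq_sw => y1 t; rewrite sw_comm.
rewrite -(sw_assoc S (f := fun y1 y2 y3 => sw (fun p q =>
    lam (p * y1) *: (q * (y2 * sS y3))) x)); try lin.
apply: eq_sw => z y3; rewrite sw_comm.
transitivity (sw (fun p q => lam p *: q) (x * z) * sS y3); last first.
  by rewrite lamR -scalerAl mul1r.
rewrite sw_mul; try lin.
rewrite (@sw_map _ _ S _ _ (fun z => z * sS y3)); last by lin.
apply: eq_sw => p q; rewrite (@sw_map _ _ S _ _ (fun z => z * sS y3)); last by lin.
by apply: eq_sw => y1 y2; rewrite -scalerAl !mulrA.
Qed.

End LeftIntegral.

(** * Nakayama automorphisms and Radford's formula *)

Section Unimodular.
Variables (K : fieldType) (H : falgType K) (S : hopf_structure H).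
Local Notation eps := (counit S).
Local Notation sS := (antipode S).
Local Notation sw := (sweedler S).
Local Notation sg := (antipode2 S).
Local Notation b i := (vbasis {:H})`_i.
Local Notation c i := (coord (vbasis {:H}) i).
Local Notation n := (\dim {:H}).
Variables (Lam : H) (intL : integral S Lam) (lam : {scalar H}).
Hypothesis lamR : forall h, sw (fun x y => lam x *: y) h = (lam h)%:A.
Hypothesis lamL : lam Lam = 1.

Let lL h : h * Lam = eps h *: Lam. Proof. by have [] := intL h. Qed.
Let rL h : Lam * h = eps h *: Lam. Proof. by have [] := intL h. Qed.

(** The mirror image of casimir, for a right integral: Lam1 h ⊗ Lam2 and
    Lam1 ⊗ Lam2 S(h) both come from Lam1 h1 ⊗ Lam2 h2 S(h3). *)
Lemma casimirR (W : vectType K) (f : H -> H -> W) h :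
    (forall y, linear (fun x => f x y)) -> (forall x, linear (f x)) ->
  sw (fun x y => f (x * h) y) Lam = sw (fun x y => f x (y * sS h)) Lam.
Proof.
move=> f1 f2.
pose G a c t := sw (fun x y => f (x * a) (y * c * sS t)) Lam.
transitivity (sw (fun a t => sw (fun c t => G a c t) t) h).
  transitivity (sw (fun a t => eps t *: sw (fun x y => f (x * a) y) Lam) h).
    by rewrite sw_epsr //; lin.
  apply: eq_sw => a t; rewrite /G sw_comm -swZ; apply: eq_sw => x y.
  transitivity (sw (fun c t => f (x * a) (y * (c * sS t))) t).
    by rewrite (sw_antir S (f := fun z => f (x * a) (y * z))) ?mulr1 //; lin.
  by apply: eq_sw => c t'; rewrite mulrA.
rewrite -(sw_assoc S (f := G)) /G; try lin.
transitivity (sw (fun u t => eps u *: sw (fun x y => f x (y * sS t)) Lam) h).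
  apply: eq_sw => u t.
  transitivity (sw (fun x y => f x (y * sS t)) (Lam * u)).
    by rewrite [RHS]sw_mul //; [rewrite sw_comm | lin].
  by rewrite rL linZ //; lin.
by rewrite sw_epsl //; lin.
Qed.

Lemma anti_lam y : sw (fun p q => lam (p * y) *: q) Lam = sS y.
Proof.
rewrite (rint_mull lamR) -[RHS](sw_epsl S (f := sS)); last by lin.
by apply: eq_sw => p q; rewrite rL linearZ /= lamL mulr1.
Qed.

Let C : 'M[K]_n := vec_mx (comul S Lam).

Let swC (f : H -> K) l :
  c l (sw (fun x y => f x *: y) Lam) = \sum_i C i l * f (b i).
Proof.
rewrite linear_sum /=; apply: eq_bigr => i _; rewrite linear_sum /=.
rewrite (bigD1 l) //= big1 => [|j /negPf jl].
  by rewrite !linearZ /= coord_b eqxx mulr1 addr0.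
by rewrite !linearZ /= coord_b eq_sym jl !mulr0.
Qed.

(** By anti_lam and the surjectivity of S, the rows of C span H. *)
Let C_unit : C \in unitmx.
Proof.
pose y (j : 'I_n) := sw (fun p q => lam (b j * p) *: q) Lam.
pose U := \matrix_(j < n, i < n) lam (b i * y j).
suff: U *m C = 1%:M by case/mulmx1_unit.
apply/matrixP=> j l; rewrite !mxE [RHS](_ : _ = c l (b j)); last first.
  by rewrite coord_b eq_sym.
rewrite -[b j](anti_surj lL lamR lamL) -anti_lam.
rewrite (swC (fun x => lam (x * y j))).
by apply: eq_bigr => i _; rewrite mxE mulrC.
Qed.

Lemma comul_lam_nondegl (k : H -> K) : scalar k ->
  sw (fun x y => k x *: y) Lam = 0 -> forall x, k x = 0.
Proof.
move=> kl k0; pose u := \row_(i < n) k (b i).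
have uC : u *m C = 0.
  apply/rowP=> l; have := congr1 (c l) k0; rewrite swC linear0 => E.
  rewrite !mxE -[RHS]E.
  by apply: eq_bigr => i _; rewrite mxE mulrC.
have u0 : u = 0 by rewrite -(mulmxK C_unit u) uC mul0mx.
move=> x; rewrite (basis_sum x) (@lin_sum _ _ K^o) // big1 // => i _.
rewrite (@linZ _ _ K^o) //.
by have := congr1 (fun v : 'rV_n => v 0 i) u0; rewrite !mxE => ->; rewrite scaler0.
Qed.

Lemma comul_lam_nondegr (k : H -> K) : scalar k ->
  sw (fun x y => k y *: x) Lam = 0 -> forall x, k x = 0.
Proof.
move=> kl k0; pose u := \col_(i < n) k (b i).
have uC : C *m u = 0.
  apply/colP=> l; have := congr1 (c l) k0; rewrite linear0 => E.
  rewrite !mxE -[RHS]E linear_sum [RHS](bigD1 l) //=.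
  rewrite [X in _ + X]big1 => [|j /negPf jl]; last first.
    rewrite linear_sum big1 // => i _.
    by rewrite !linearZ /= coord_b eq_sym jl !mulr0.
  rewrite addr0 [RHS]linear_sum; apply: eq_bigr => i _.
  by rewrite !linearZ /= coord_b eqxx mulr1 [u i 0]mxE.
have u0 : u = 0 by rewrite -(mulKmx C_unit u) uC mulmx0.
move=> x; rewrite (basis_sum x) (@lin_sum _ _ K^o) // big1 // => i _.
rewrite (@linZ _ _ K^o) //.
by have := congr1 (fun v : 'cV_n => v i 0) u0; rewrite !mxE => ->; rewrite scaler0.
Qed.

(** Paired with Lam2, the forms lam(S^2(y) _) and lam(_ y) evaluated at Lam1 give
    the same element S(y), and Lam1 ⊗ Lam2 is nondegenerate. *)
Lemma lam_nakayama y z : lam (sg y * z) = lam (z * y).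
Proof.
pose k x := lam (sg y * x) - lam (x * y).
apply/eqP; rewrite -subr_eq0; apply/eqP; rewrite -[LHS]/(k z).
have kl : scalar k.
  have k1 : scalar (fun x => lam (sg y * x)) by lin.
  have k2 : scalar (fun x => lam (x * y)) by lin.
  by move=> a u v; rewrite /k k1 k2 mulrBr opprD addrACA.
apply: comul_lam_nondegl => //; rewrite /k.
transitivity (sw (fun p q => lam (sg y * p) *: q) Lam -
              sw (fun p q => lam (p * y) *: q) Lam).
  rewrite -sumrB; apply: eq_bigr => i _; rewrite -sumrB; apply: eq_bigr => j _.
  by rewrite scalerBl scalerBr.
apply/eqP; rewrite subr_eq0 anti_lam; apply/eqP.
by apply: (anti_inj lL lamR lamL); rewrite (anti_surj lL lamR lamL).
Qed.

(** Integrals of the dual algebra form a line. *)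
Lemma rint_uniq (k : H -> K) : scalar k ->
    (forall h, sw (fun x y => k x *: y) h = (k h)%:A) ->
  forall h, k h = k Lam * lam h.
Proof.
move=> kl kR h; pose d x := k x - k Lam * lam x.
apply/eqP; rewrite -subr_eq0; apply/eqP; rewrite -[LHS]/(d h).
have dl : scalar d.
  have k2 : scalar (fun x => k Lam * lam x) by lin.
  by move=> a u v; rewrite /d kl k2 mulrBr opprD addrACA.
apply: comul_lam_nondegl => //; rewrite /d.
transitivity (sw (fun p q => k p *: q) Lam -
              k Lam *: sw (fun p q => lam p *: q) Lam).
  rewrite -swZ -sumrB; apply: eq_bigr => i _; rewrite -sumrB.
  by apply: eq_bigr => j _; rewrite scalerBl scalerBr !scalerA !mulrA.
by rewrite kR lamR lamL scale1r subrr.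
Qed.

(** The distinguished grouplike element of H, which measures how far lam is from
    being a left integral as well (lam_grouplike). *)
Definition dist_grouplike := sw (fun x y => lam y *: x) Lam.
Local Notation g := dist_grouplike.

(** For every form f, h |-> f(h1) lam(h2) is again an integral, hence a multiple
    of lam. *)
Lemma lam_grouplike h : sw (fun x y => lam y *: x) h = lam h *: g.
Proof.
have kR i := @rint_uniq (fun h => c i (sw (fun x y => lam y *: x) h)).
rewrite [LHS]basis_sum [RHS]basis_sum; apply: eq_bigr => i _; congr (_ *: _).
rewrite kR; first by rewrite linearZ /= mulrC.
  by lin.
move=> {}h; pose G x y z := (lam y * c i x) *: z : H.
transitivity (sw (fun t z => sw (fun x y => G x y z) t) h).
  apply: eq_sw => t z; rewrite (@sw_map _ _ S _ _ (fun x => c i x *: z)); last by lin.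
  by apply: eq_sw => x y; rewrite linearZ.
rewrite (sw_assoc S (f := G)) /G; try lin.
transitivity (sw (fun x t => (lam t * c i x) *: (1 : H)) h).
  apply: eq_sw => x t; under eq_sw => y z do rewrite mulrC -scalerA.
  by rewrite swZ lamR scalerA mulrC.
rewrite (@sw_map _ _ S _ _ (fun x => c i x *: (1 : H))); last by lin.
by apply: eq_sw => x y; rewrite linearZ.
Qed.

(** h1 ⊗ h2 lam(h3) is lam(h) times the comultiplication of g, and also
    h1 ⊗ lam(h2) g, that is lam(h) g ⊗ g. *)
Lemma dist_grouplikeP (W : vectType K) (f : H -> H -> W) :
    (forall y, linear (fun x => f x y)) -> (forall x, linear (f x)) ->
  sw f g = f g g.
Proof.
move=> f1 f2; rewrite {1}/dist_grouplike (@sw_map _ _ S _ _ (sw f)); last by lin.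
transitivity (sw (fun x z => sw (fun x y => lam z *: f x y) x) Lam).
  by apply: eq_sw => x y; rewrite swZ linZ //; lin.
rewrite (sw_assoc S (f := fun x y z => lam z *: f x y)); try lin.
transitivity (sw (fun x y => f x (lam y *: g)) Lam).
  apply: eq_sw => x y; rewrite -lam_grouplike (@sw_map _ _ S _ _ (f x)) //.
  by apply: eq_sw => p q; rewrite linZ.
transitivity (f (sw (fun x y => lam y *: x) Lam) g) => //.
rewrite (@sw_map _ _ S _ _ (fun x => f x g)) //.
by apply: eq_sw => x y; rewrite (@linZ _ _ _ (f x)) // (@linZ _ _ _ (fun x => f x g)).
Qed.

Lemma eps_dist_grouplike : eps g = 1.
Proof.
rewrite -lamL -[in RHS](sw_epsl S (f := fun x => x) Lam) //.
rewrite (@sw_map _ _ S _ K^o (eps : H -> K^o)); last exact: linearP.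
rewrite (@sw_map _ _ S _ K^o (lam : H -> K^o)); last exact: linearP.
by apply: (@eq_sw _ _ S K^o) => x y; rewrite !linearZ /= mulrC.
Qed.

Lemma anti_dist_grouplike_l : sS g * g = 1.
Proof.
rewrite -(dist_grouplikeP (f := fun x y => sS x * y)); try lin.
by rewrite (sw_antil S (f := id)) // eps_dist_grouplike scale1r.
Qed.

Lemma anti_dist_grouplike_r : g * sS g = 1.
Proof.
rewrite -(dist_grouplikeP (f := fun x y => x * sS y)); try lin.
by rewrite (sw_antir S (f := id)) // eps_dist_grouplike scale1r.
Qed.

Let mu h := lam (g * h).

(** Replacing lam by lam(g _) exchanges right and left integrals, which gives a
    second form whose symmetry defect is known. *)
Lemma mu_lint h : sw (fun x y => mu y *: x) h = (mu h)%:A.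
Proof.
rewrite /mu -anti_dist_grouplike_l scalerAr -lam_grouplike sw_mul; try lin.
rewrite (dist_grouplikeP (f := fun x1 x2 => sw (fun y1 y2 => lam (x2 * y2) *: (x1 * y1)) h));
  try lin.
rewrite (@sw_map _ _ S _ _ (fun x => sS g * x)); last by lin.
by apply: eq_sw => x y; rewrite -scalerAr mulrA anti_dist_grouplike_l mul1r.
Qed.

Let mu_scalar : scalar mu. Proof. by rewrite /mu; lin. Qed.

Lemma anti_mu y : sw (fun p q => mu (y * q) *: p) Lam = sS y.
Proof.
transitivity (sw (fun p q => sw (fun y1 y2 => eps y1 *: (mu (y2 * q) *: p)) y) Lam).
  by apply: eq_sw => p q; rewrite sw_epsl //; lin.
transitivity (sw (fun p q => sw (fun t y3 => sw (fun y1 y2 =>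
    mu (y3 * q) *: (sS y1 * y2 * p)) t) y) Lam).
  apply: eq_sw => p q; apply: eq_sw => y1 y2.
  by rewrite (sw_antil S (f := fun z => mu (y2 * q) *: (z * p))) ?mul1r //; lin.
rewrite sw_comm.
transitivity (sw (fun t y3 => sw (fun y1 y2 => sw (fun p q =>
    mu (y3 * q) *: (sS y1 * y2 * p)) Lam) t) y).
  by apply: eq_sw => y1 t; rewrite sw_comm.
rewrite (sw_assoc S (f := fun y1 y2 y3 => sw (fun p q =>
    mu (y3 * q) *: (sS y1 * y2 * p)) Lam)); try lin.
transitivity (sw (fun y1 z => eps z *: sS y1) y); last first.
  by rewrite sw_epsr //; lin.
apply: eq_sw => y1 z.
transitivity (sS y1 * sw (fun p q => mu q *: p) (z * Lam)).
  rewrite sw_mul; try lin.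
  rewrite (@sw_map _ _ S _ _ (fun z => sS y1 * z)); last by lin.
  apply: eq_sw => y2 y3; rewrite (@sw_map _ _ S _ _ (fun z => sS y1 * z)); last by lin.
  by apply: eq_sw => p q; rewrite -scalerAr !mulrA.
rewrite mu_lint lL -scalerAr mulr1 (@linZ _ _ K^o) //; congr (_ *: _).
by rewrite /mu lL eps_dist_grouplike scale1r lamL; exact: mulr1.
Qed.

(** The mirror image of lam_nakayama: both forms paired with Lam1 give S(y). *)
Lemma mu_nakayama y z : mu (y * z) = mu (z * sg y).
Proof.
pose k x := mu (y * x) - mu (x * sg y).
apply/eqP; rewrite -subr_eq0; apply/eqP; rewrite -[LHS]/(k z).
have kl : scalar k.
  have k1 : scalar (fun x => mu (y * x)) by lin.
  have k2 : scalar (fun x => mu (x * sg y)) by lin.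
  by move=> a u v; rewrite /k k1 k2 mulrBr opprD addrACA.
apply: comul_lam_nondegr => //; rewrite /k.
transitivity (sw (fun p q => mu (y * q) *: p) Lam -
              sw (fun p q => mu (q * sg y) *: p) Lam).
  rewrite -sumrB; apply: eq_bigr => i _; rewrite -sumrB; apply: eq_bigr => j _.
  by rewrite scalerBl scalerBr.
apply/eqP; rewrite subr_eq0 anti_mu antipode2E.
rewrite -(casimirR (f := fun p q => mu q *: p)); try lin.
apply/eqP; transitivity (sw (fun p q => mu q *: p) Lam * sS y).
  by rewrite mu_lint /mu lL eps_dist_grouplike scale1r lamL scale1r mul1r.
rewrite (@sw_map _ _ S _ _ (fun z => z * sS y)); last by lin.
by apply: eq_sw => p q; rewrite -scalerAl.
Qed.

Lemma lam_nondeg x : (forall y, lam (x * y) = 0) -> x = 0.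
Proof.
move=> x0; rewrite -(dual_basis lL lamR lamL x) /sweedler.
by rewrite big1 // => i _; rewrite big1 // => j _; rewrite x0 scale0r scaler0.
Qed.

(** Radford's formula for unimodular H: evaluate lam(g z y) with mu_nakayama and
    then with lam_nakayama, and cancel the nondegenerate lam. *)
Lemma radford z : sg (sg z) * g = g * z.
Proof.
apply/eqP; rewrite -subr_eq0; apply/eqP; apply: lam_nondeg => y.
rewrite mulrBl linearB /= -[g * z * y]mulrA -/(mu _) mu_nakayama /mu.
by rewrite [g * (y * _)]mulrA -(lam_nakayama (sg z)) !mulrA subrr.
Qed.

End Unimodular.

(** * Finite order and innerness of the squared antipode *)

Section Grouplike.
Variables (K : fieldType) (H : falgType K) (S : hopf_structure H).
Local Notation sw := (sweedler S).

Definition grouplike (x : H) := comul S x == x ⊗ x.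

Lemma grouplikeP (W : vectType K) (f : H -> H -> W) x : grouplike x ->
    (forall y, linear (fun x => f x y)) -> (forall x, linear (f x)) ->
  sw f x = f x x.
Proof. by move=> /eqP Dx f1 f2; rewrite swE Dx tens_liftE. Qed.

Lemma grouplikeM x y : grouplike x -> grouplike y -> grouplike (x * y).
Proof.
move=> gx gy; apply/eqP; rewrite [LHS]tens_decomp -swE sw_mul; try lin.
rewrite (grouplikeP (f := fun x1 x2 =>
   sw (fun y1 y2 => (x1 * y1) ⊗ (x2 * y2)) y) gx); try lin.
by rewrite (grouplikeP (f := fun y1 y2 => (x * y1) ⊗ (x * y2)) gy) //; lin.
Qed.

Lemma grouplikeX x k : grouplike x -> grouplike (x ^+ k).
Proof.
move=> gx; elim: k => [|k IHk]; first by rewrite /grouplike comul1.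
by rewrite exprS grouplikeM.
Qed.

(** Artin's independence of characters in dual form: comparing coordinates in
    Delta(x) = x ⊗ x, the coordinates of x on independent grouplikes are orthogonal
    idempotents of K, so x is one of these grouplikes. *)
Lemma grouplike_free (s : seq H) :
  all grouplike s -> 0 \notin s -> uniq s -> free s.
Proof.
elim: s => [|x s IHs]; first by rewrite nil_free.
rewrite inE negb_or /= => /andP[gx gs] /andP[x0 s0] /andP[xs us].
have fs := IHs gs s0 us; rewrite free_cons fs andbT.
apply/negP => sx; pose X := in_tuple s.
have Dx : x = \sum_(i < size s) coord X i x *: X`_i by exact: coord_span.
have gX (i : 'I_(size s)) : grouplike X`_i.
  exact: (allP gs) (mem_nth _ (ltn_ord i)).
have cX (i k : 'I_(size s)) : coord X i X`_k = (k == i)%:R.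
  by rewrite coord_free //.
have cc (i j : 'I_(size s)) :
    coord X i x * coord X j x = (i == j)%:R * coord X i x.
  have f1 y : scalar (fun x => coord X i x * coord X j y) by lin.
  have f2 y : scalar (fun x => coord X i y * coord X j x) by lin.
  pose f x y : K^o := coord X i x * coord X j y.
  have fP y : grouplike y -> sw f y = f y y by move=> /(grouplikeP (f := f)) ->.
  have fl : linear (sw f) by lin.
  rewrite -[LHS]/(f x x) -fP // {1}Dx lin_sum // (bigD1 i) //= big1 => [|k /negPf ki].
    by rewrite linZ // fP // /f !cX eqxx mul1r addr0 mulrC.
  by rewrite linZ // fP // /f !cX ki mul0r scaler0.
have [i ci|c0] := pickP (fun i => coord X i x != 0); last first.
  case/eqP: x0; rewrite Dx big1 // => i _.
  by have /negbFE/eqP-> := c0 i; rewrite scale0r.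
case/negP: xs; suff ->: x = X`_i by exact: mem_nth.
have ci1 : coord X i x = 1.
  by apply: (mulfI ci); rewrite cc eqxx mul1r mulr1.
rewrite Dx (bigD1 i) //= big1 ?addr0 ?ci1 ?scale1r // => j /negPf ji.
by have := cc i j; rewrite ci1 eq_sym ji mul1r mul0r => ->; rewrite scale0r.
Qed.

(** The powers of x are grouplike, so there are at most dim H of them. *)
Lemma grouplike_order x : grouplike x -> x \is a GRing.unit ->
  exists2 N, (0 < N)%N & x ^+ N = 1.
Proof.
move=> gx ux; pose n := \dim {:H}; pose s := [seq x ^+ i | i <- iota 0 n.+1].
have nf : ~~ free s.
  rewrite /free size_map size_iota neq_ltn ltnS.
  by rewrite [(_ <= n)%N]dimvS ?subvf.
have s0 : 0 \notin s.
  apply/mapP => -[i _ /eqP]; rewrite eq_sym => /eqP xi.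
  by have := unitrX i ux; rewrite xi unitr0.
have ns : ~~ uniq s.
  apply: contra nf => us; apply: grouplike_free => //.
  by apply/allP => _ /mapP[i _ ->]; exact: grouplikeX.
have /(uniqPn 0)[i [j [ij]]] := ns.
rewrite size_map size_iota => jn.
have nE k : (k < n.+1)%N -> s`_k = x ^+ k.
  by move=> kn; rewrite (nth_map 0%N) ?size_iota // nth_iota.
rewrite !nE // ?(ltn_trans ij) // => E; exists (j - i)%N; first by rewrite subn_gt0.
by apply: (mulIr (unitrX i ux)); rewrite -exprD subnK ?mul1r // ltnW.
Qed.

End Grouplike.

Section InnerSquare.
Variables (K : fieldType) (H : falgType K) (S : hopf_structure H).
Local Notation eps := (counit S).
Local Notation sS := (antipode S).
Local Notation sw := (sweedler S).
Local Notation sg := (antipode2 S).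
Variables (Lam : H) (intL : integral S Lam) (lam : {scalar H}).
Hypothesis lamR : forall h, sw (fun x y => lam x *: y) h = (lam h)%:A.
Hypothesis lamL : lam Lam = 1.
Let lL h : h * Lam = eps h *: Lam. Proof. by have [] := intL h. Qed.
Local Notation g := (dist_grouplike S Lam lam).

Lemma dist_grouplike_unit : g \is a GRing.unit.
Proof.
apply/unitrP; exists (sS g).
by rewrite (anti_dist_grouplike_l intL) // (anti_dist_grouplike_r intL).
Qed.

Lemma antipode2_finite_order : exists2 M, (0 < M)%N & forall z, iter M sg z = z.
Proof.
have gg : grouplike S g.
  by apply/eqP; rewrite [LHS]tens_decomp -swE (dist_grouplikeP intL) //; lin.
have [N N0 gN] := grouplike_order gg dist_grouplike_unit.
exists N.*2; first by rewrite double_gt0.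
move=> z; have itE k : iter k.*2 sg z * g ^+ k = g ^+ k * z.
  elim: k => [|k IHk]; first by rewrite mulr1 mul1r.
  by rewrite doubleS !iterS exprS mulrA (radford intL) // -!mulrA IHk.
by have := itE N; rewrite gN mulr1 mul1r.
Qed.

(** The element for which tr (x |-> x h) = lam(twist_elt h).  By the Casimir
    property it implements S^2 as an inner automorphism (twist_elt_comm). *)
Definition twist_elt := sw (fun x y => sg x * sS y) Lam.

Lemma twist_elt_comm y : twist_elt * y = sg y * twist_elt.
Proof.
rewrite /twist_elt (@sw_map _ _ S _ _ (fun z => z * y)); last by lin.
rewrite (@sw_map _ _ S _ _ (fun z => sg y * z)); last by lin.
transitivity (sw (fun a c => sg a * (sS c * y)) Lam).
  by apply: eq_sw => a c; rewrite mulrA.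
rewrite -(casimir lL (f := fun a c => sg a * c)); try lin.
by apply: eq_sw => a c; rewrite antipode2M mulrA.
Qed.

Lemma antipode2_twist_elt : sS Lam = Lam -> sg twist_elt = twist_elt.
Proof.
move=> SL; rewrite /twist_elt sw_map; last by lin.
transitivity (sw (fun a c => sg a * sS c) (sg Lam)); last by rewrite antipode2E !SL.
by rewrite sw_antipode2; [apply: eq_sw => a c; rewrite antipode2M !antipode2E | lin | lin].
Qed.

(** The right annihilator of twist_elt is a left ideal, so it is generated by an
    idempotent e.  The rank of e is the trace of right multiplication by e, which is
    lam(twist_elt e) = 0. *)
Lemma twist_elt_reg (charK : [pchar K] =i pred0) (ssH : semisimple_algebra H) y :
  twist_elt * y = 0 -> y = 0.
Proof.
pose I := lker (amull twist_elt).
have inI x : (x \in I) = (twist_elt * x == 0) by rewrite memv_ker lfunE.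
have [|e] := @left_ideal_unit _ _ ssH I.
  by move=> h x; rewrite !inI => /eqP vx; rewrite mulrA twist_elt_comm -mulrA vx mulr0.
rewrite inI => /eqP e0 Ie.
have ee : e * e = e by apply: Ie; rewrite inI e0.
suff e00 : e = 0 by move=> /eqP; rewrite -inI => /Ie <-; rewrite e00 mulr0.
have el : linear (fun x => x * e) by lin.
have [r Dr [_ r0 _]] := tr_idem el (fun x => etrans (esym (mulrA x e e)) (congr1 _ ee)).
have /r0 Re : r = 0%N.
  apply/eqP; rewrite -((pcharf0P K).1 charK) -Dr (trace_casimir lL lamR lamL el).
  rewrite -[X in _ == X](linear0 lam) -e0 /twist_elt.
  rewrite (@sw_map _ _ S _ _ (fun x => x * e)); last by lin.
  rewrite (@sw_map _ _ S _ K^o (lam : H -> K^o)); last exact: linearP.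
  apply/eqP/(@eq_sw _ _ S K^o) => a c.
  by rewrite -(lam_nakayama intL) // mulrA.
by rewrite -[e]mul1r Re.
Qed.

End InnerSquare.

(** * Primitive idempotents fixed by an inner automorphism *)

(** The case U = V serves for Schur's lemma, proper subspaces U for corners of an
    algebra. *)
Lemma eigenvector_in (K : closedFieldType) (V : vectType K) (phi : V -> V)
    (U : {vspace V}) : linear phi -> U != 0%VS ->
    (forall x, x \in U -> phi x \in U) ->
  exists c x, [/\ x \in U, x != 0 & phi x = c *: x].
Proof.
move=> pl U0 pU; pose u i := (vbasis U)`_i; pose m := \dim U.
have uU (i : 'I_m) : u i \in U by rewrite vbasis_mem ?mem_nth ?size_tuple.
pose A := \matrix_(i < m, j < m) coord (vbasis U) j (phi (u i)).
have [a ra] : exists a, root (char_poly A) a.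
  by apply/closed_rootP; rewrite size_char_poly eqSS dimv_eq0.
move: ra; rewrite -eigenvalue_root_char => /eigenvalueP[w wA w0].
exists a, (\sum_(i < m) w 0 i *: u i); split.
- by apply: memv_suml => i _; apply: memvZ.
- apply: contra w0 => /eqP E; have /freeP F := basis_free (vbasisP U).
  by apply/eqP/rowP=> i; rewrite (F (fun i => w 0 i) E) mxE.
rewrite lin_sum // scaler_sumr.
transitivity (\sum_(i < m) \sum_(j < m) (w 0 i * A i j) *: u j).
  apply: eq_bigr => i _; rewrite linZ // {1}(coord_vbasis (pU _ (uU i))).
  by rewrite scaler_sumr; apply: eq_bigr => j _; rewrite scalerA mxE.
rewrite exchange_big; apply: eq_bigr => j _; rewrite scalerA -scaler_suml.
by have := congr1 (fun v : 'rV_m => v 0 j) wA; rewrite !mxE => ->.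
Qed.

(** Here s is an automorphism of finite order M, implemented by the s-fixed regular
    element v. *)
Section Splitting.
Variables (K : closedFieldType) (H : falgType K).
Hypothesis charK : [pchar K] =i pred0.
Hypothesis ssH : semisimple_algebra H.
Variables (s : {linear H -> H}) (v : H) (M : nat).
Hypothesis sM : forall x y, s (x * y) = s x * s y.
Hypothesis M0 : (0 < M)%N.
Hypothesis sMK : forall x, iter M s x = x.
Hypothesis vs : forall y, v * y = s y * v.
Hypothesis sv : s v = v.
Hypothesis vreg : forall y, v * y = 0 -> y = 0.
Local Notation b i := (vbasis {:H})`_i.
Local Notation n := (\dim {:H}).

(** A boolean form of e H e = K e, which is primitivity in a semisimple
    algebra over a closed field. *)
Definition primitive_idem (e : H) := [forall i : 'I_n, e * b i * e \in <[e]>%VS].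

Lemma primitive_idemP e : reflect (forall x, exists k, e * x * e = k *: e) (primitive_idem e).
Proof.
apply: (iffP forallP) => [pe x|pe i]; last first.
  by have [k ->] := pe (b i); rewrite memvZ ?memv_line.
apply/vlineP; rewrite (basis_sum x) mulr_sumr mulr_suml memv_suml // => i _.
by rewrite -scalerAr -scalerAl memvZ.
Qed.

(** If v e is not a multiple of e it is itself such an element; otherwise s is
    trivial on the corner e H e. *)
Lemma split_fixed e : e * e = e -> s e = e -> e != 0 -> ~~ primitive_idem e ->
  exists z, [/\ e * z = z, z * e = z, s z = z & z \notin <[e]>%VS].
Proof.
move=> ee se e0 /forallPn[i ni].
have ev : v * e = e * v by rewrite vs se.
have [vek|vek] := boolP (v * e \in <[e]>%VS); last first.
  by exists (v * e); rewrite sM sv se -mulrA ee mulrA -ev -mulrA ee.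
have {vek}/vlineP[w vew] := vek.
have w0 : w != 0.
  apply: contra e0 => /eqP w0; apply/eqP/vreg.
  by rewrite vew w0 scale0r.
set z := e * b i * e in ni; exists z.
have ez : e * z = z by rewrite /z !mulrA ee.
have ze : z * e = z by rewrite /z -!mulrA ee.
split=> //; apply: (scalerI w0).
have sze : s z * e = s z by rewrite -{1}se -sM ze.
rewrite -{1}sze -{2}ez scalerAr scalerAl -vew {1}ev mulrA sze -vs.
by rewrite -mulrA ez.
Qed.

(** An s-fixed z in e H e that is not a multiple of e yields, after subtraction of
    an eigenvalue, a nonzero s-fixed z' in e H e which is not invertible there.  The
    left ideal H z' is stable under s, and the average of the translates under s of
    a right unit of this ideal is an s-fixed right unit; cutting it by e gives the
    desired idempotent. *)
Lemma split_idem e : e * e = e -> s e = e -> e != 0 -> ~~ primitive_idem e ->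
  exists f, [/\ f * f = f, s f = f, e * f = f, f * e = f & (f != 0) && (f != e)].
Proof.
move=> ee se e0 npe; have [z [ez ze sz zne]] := split_fixed ee se e0 npe.
pose U := limg (amull e).
have UE x : (x \in U) = (e * x == x).
  apply/memv_imgP/eqP => [[y _ ->]|ex]; first by rewrite lfunE /= mulrA ee.
  by exists x; rewrite ?memvf // lfunE.
have [|||c [x []]] := @eigenvector_in _ _ (fun x => z * x) U.
- by lin.
- by apply/eqP => U0; have := UE e; rewrite U0 memv0 ee eqxx (negPf e0).
- by move=> x; rewrite !UE mulrA ez.
rewrite UE => /eqP ex x0 zx.
pose z' := z - c *: e.
have z'0 : z' != 0.
  by apply: contra zne; rewrite subr_eq0 => /eqP->; rewrite memvZ ?memv_line.
have z'x : z' * x = 0 by rewrite mulrBl zx -scalerAl ex subrr.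
have z'e : z' * e = z' by rewrite mulrBl ze -scalerAl ee.
have sz' : s z' = z' by rewrite linearB linearZ /= sz se.
pose I : {vspace H} := limg (amulr z').
have IP y : reflect (exists h, y = h * z') (y \in I).
  apply: (iffP memv_imgP) => [[h _ ->]|[h ->]]; exists h => //; rewrite ?lfunE //.
  exact: memvf.
have lI : left_ideal I by move=> h y /IP[k ->]; apply/IP; exists (h * k); rewrite mulrA.
have sI y : y \in I -> s y \in I.
  by move=> /IP[h ->]; apply/IP; exists (s h); rewrite sM sz'.
have itI k y : y \in I -> iter k s y \in I by elim: k => //= k IHk /IHk/sI.
have [u Iu yu] := left_ideal_unit ssH lI.
(* Translates of a right unit by s are right units, since s maps H z' onto itself. *)
have yuk k y : y \in I -> y * iter k s u = y.
  elim: k y => [|k IHk] y Iy; first exact: yu.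
  have Dy : y = s (iter M.-1 s y) by rewrite -iterS prednK.
  by rewrite iterS {1}Dy -sM IHk ?itI // -Dy.
pose u' := M%:R^-1 *: \sum_(k < M) iter k s u.
have MK : M%:R != 0 :> K by rewrite (pcharf0P K).1 // -lt0n.
have Iu' : u' \in I by rewrite memvZ // memv_suml // => k _; exact: itI.
have yu' y : y \in I -> y * u' = y.
  move=> Iy; rewrite -scalerAr mulr_sumr (eq_bigr (fun=> y)); last by move=> k _; exact: yuk.
  by rewrite sumr_const card_ord -scaler_nat scalerA mulVf // scale1r.
have su' : s u' = u'.
  rewrite linearZ linear_sum; congr (_ *: _); apply: (addrI u).
  transitivity (\sum_(k < M.+1) iter k s u); first by rewrite big_ord_recl.
  by rewrite big_ord_recr /= sMK addrC.
have Ie y : y \in I -> y * e = y by move=> /IP[h ->]; rewrite -mulrA z'e.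
have If : e * u' \in I by exact: lI.
have yf y : y \in I -> y * (e * u') = y by move=> Iy; rewrite mulrA Ie // yu'.
exists (e * u'); split.
- exact: yf.
- by rewrite sM se su'.
- by rewrite mulrA ee.
- exact: Ie.
apply/andP; split.
  apply: contra z'0 => /eqP f0; rewrite -(yf z') ?f0 ?mulr0 //.
  by apply/IP; exists 1; rewrite mul1r.
apply: contra x0 => /eqP fe; rewrite -ex -fe.
by have /IP[h ->] := If; rewrite -mulrA z'x mulr0.
Qed.

Lemma primitive_decomposition e : e * e = e -> s e = e -> e != 0 ->
  exists es : seq H, [/\ \sum_(x <- es) x = e, uniq es,
    {in es &, forall x y, x != y -> x * y = 0} &
    forall x, x \in es ->
      [/\ x * x = x, s x = x, x != 0, primitive_idem x & e * x = x /\ x * e = x]].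
Proof.
have [m] := ubnP (\dim (limg (amull e))); elim: m e => // m IHm e.
rewrite ltnS => dm ee se e0.
have [pe|] := boolP (primitive_idem e).
  exists [:: e]; split=> [|//|x y|x]; first by rewrite big_seq1.
    by rewrite !inE => /eqP-> /eqP->; rewrite eqxx.
  by rewrite inE => /eqP->.
case/(split_idem ee se e0) => f [ff sf ef fe /andP[f0 fne]].
have small h : h * h = h -> e * h = h -> h != e -> h * e = h ->
    (\dim (limg (amull h)) < m)%N.
  move=> hh eh hne he; apply: leq_trans dm; rewrite ltn_neqAle.
  have sub : (limg (amull h) <= limg (amull e))%VS.
    apply/subvP => _ /memv_imgP[y _ ->]; apply/memv_imgP.
    by exists (h * y); rewrite ?memvf // !lfunE /= mulrA eh.
  rewrite dimvS // andbT; apply: contra hne => /eqP dE.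
  have /eqP E : limg (amull h) == limg (amull e) by rewrite eqEdim sub dE leqnn.
  have : e \in limg (amull e).
    by apply/memv_imgP; exists 1; rewrite ?memvf // lfunE /= mulr1.
  rewrite -E => /memv_imgP[y _]; rewrite lfunE /= => Dy.
  by rewrite -he Dy mulrA hh.
(* Both pieces of e = f + f' have smaller right ideals f H and f' H. *)
pose f' := e - f.
have f'f' : f' * f' = f' by rewrite mulrBl !mulrBr ee ef fe ff subrr subr0.
have ff' : f * f' = 0 by rewrite mulrBr fe ff subrr.
have f'f : f' * f = 0 by rewrite mulrBl ef ff subrr.
have f'0 : f' != 0 by rewrite subr_eq0 eq_sym.
have ef' : e * f' = f' by rewrite mulrBr ee ef.
have f'e : f' * e = f' by rewrite mulrBl ee fe.
have f'ne : f' != e.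
  by apply: contra f0 => /eqP fE; rewrite -ef -fE f'f.
have sf' : s f' = f' by rewrite linearB /= se sf.
have [es [sum_es ues oes Pes]] := IHm f (small f ff ef fne fe) ff sf f0.
have [es' [sum_es' ues' oes' Pes']] := IHm f' (small f' f'f' ef' f'ne f'e) f'f' sf' f'0.
have cross x y : x \in es -> y \in es' -> x * y = 0 /\ y * x = 0.
  move=> /Pes[_ _ _ _ [fx xf]] /Pes'[_ _ _ _ [fy yf]].
  rewrite -{1}xf -{1}fy -{2}yf -{2}fx !mulrA -[x * f * f']mulrA ff'.
  by rewrite -[y * f' * f]mulrA f'f !mulr0 !mul0r.
exists (es ++ es'); split.
- by rewrite big_cat /= sum_es sum_es' addrC subrK.
- rewrite cat_uniq ues ues' andbT; apply/hasPn => x x'; apply/negP => /= xes.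
  have [xx _ x0 _ _] := Pes _ xes.
  by case/eqP: x0; rewrite -xx; have [] := cross _ _ xes x'.
- move=> x y; rewrite !mem_cat => /orP[] xs /orP[] ys.
  + exact: oes.
  + by have [] := cross _ _ xs ys.
  + by have [] := cross _ _ ys xs.
  + exact: oes'.
move=> x; rewrite mem_cat => /orP[/Pes|/Pes'] [xx sx x0 px [ux xu]]; split=> //.
  by split; [rewrite -{1}ux mulrA ef ux | rewrite -{1}xu -mulrA fe xu].
by split; [rewrite -{1}ux mulrA ef' ux | rewrite -{1}xu -mulrA f'e xu].
Qed.

End Splitting.

(** * The trace of an inner automorphism of finite order *)

Local Notation intp R p := (map_poly (intr : int -> R) p).

Lemma intr_eq0_char0 (K : fieldType) (charK : [pchar K] =i pred0) (a : int) :
  (a%:~R == 0 :> K) = (a == 0).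
Proof.
case: a => m; first by rewrite -pmulrn (pcharf0P K).1.
by rewrite NegzE mulrNz oppr_eq0 -pmulrn (pcharf0P K).1 // oppr_eq0.
Qed.

(** If P and Q had no common root in algC, they would be coprime over the rationals,
    and a Bezout relation with cleared denominators would give a nonzero integer
    that vanishes in K. *)
Lemma common_root_algC (K : fieldType) (charK : [pchar K] =i pred0)
    (P Q : {poly int}) (x : K) : Q != 0 ->
    root (intp K P) x -> root (intp K Q) x ->
  exists z : algC, root (intp algC P) z /\ root (intp algC Q) z.
Proof.
move=> Q0 Px Qx; have [|ncop] := boolP (coprimep P Q).
  case/Bezout_coprimepP => -[u1 u2] /eqpP[[a1 a2] /andP[/= _ a20] E].
  have := congr1 (fun p => (intp K p).[x]) E.
  rewrite !map_polyZ rmorphD !rmorphM rmorph1 !hornerE /=.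
  rewrite (rootP Px) (rootP Qx) !mulr0 addr0 mulr0 => /esym/eqP.
  by rewrite intr_eq0_char0 // (negPf a20).
have sz (p : {poly int}) : size (intp algC p) = size p.
  by apply: size_map_inj_poly => //; exact: intr_inj.
have [|z Gz] := closed_rootP (intp algC (gcdp P Q)) _.
  by rewrite sz.
have tr p : gcdp P Q %| p -> root (intp algC p) z.
  case/Pdiv.Idomain.dvdpP => -[a q] /= a0 E.
  have := congr1 (fun p => (intp algC p).[z]) E.
  rewrite map_polyZ rmorphM !hornerE /= (rootP Gz) mulr0 => /eqP.
  by rewrite mulf_eq0 intr_eq0 (negPf a0).
by exists z; split; apply: tr; rewrite ?dvdp_gcdl ?dvdp_gcdr.
Qed.

Lemma prim_root_exists (K : closedFieldType) (charK : [pchar K] =i pred0) M :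
  (0 < M)%N -> exists z : K, M.-primitive_root z.
Proof.
move=> M0; have [rs] := closed_field_poly_normal ('X^M - 1 : {poly K}).
have mon : 'X^M - 1 \is @monic K by rewrite monicXnsubC.
rewrite (monicP mon) scale1r => Drs.
have /hasP[z _ zP] : has M.-primitive_root rs.
  apply: has_prim_root => //.
  - by apply/allP => z zrs; rewrite /root_of_unity Drs root_prod_XsubC.
  - rewrite -separable_prod_XsubC -Drs separable_Xn_sub_1 //.
    by rewrite (pcharf0P K).1 // -lt0n.
  - by rewrite -ltnS -(size_prod_XsubC rs id) -Drs size_XnsubC.
by exists z.
Qed.

(** In the complex numbers the sum over one fibre of r is the squared modulus of
    the sum of the u i over this fibre.  The fibre reduced to i0 contributes 1 and no
    fibre contributes a negative number.  This argument is carried over to K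
    with a common root of X^M - 1 and of the integer polynomial that expresses the
    sum in terms of a primitive root of unity. *)
Lemma sum_unity_roots_neq0 (K : closedFieldType) (charK : [pchar K] =i pred0)
    (I : finType) (r : I -> I) (u : I -> K) M (i0 : I) : (0 < M)%N ->
    (forall i, u i ^+ M = 1) -> (forall i, r i = r i0 -> i = i0) ->
  \sum_i \sum_(j | r i == r j) u i / u j != 0.
Proof.
move=> M0 uM i0P; have [w wP] := prim_root_exists charK M0.
pose k i := sval (prim_rootP wP (uM i)).
have uE i : u i = w ^+ k i by rewrite /k; case: (prim_rootP _ _).
(* Inverses are written as powers with exponent M - 1 to stay within polynomials. *)
pose P : {poly int} := \sum_i \sum_(j | r i == r j) 'X^(k i + M.-1 * k j).
have PE (R : fieldType) (x : R) : (intp R P).[x] =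
    \sum_i \sum_(j | r i == r j) x ^+ k i * (x ^+ M.-1) ^+ k j.
  rewrite rmorph_sum horner_sum; apply: eq_bigr => i _.
  rewrite rmorph_sum horner_sum; apply: eq_bigr => j _.
  by rewrite /= map_polyXn hornerXn exprD exprM.
have invE (R : fieldType) (x : R) : x ^+ M = 1 -> x ^+ M.-1 = x^-1.
  move=> xM; have x0 : x != 0.
    by apply/eqP => x0; move/eqP: xM; rewrite x0 expr0n gtn_eqF // eq_sym oner_eq0.
  by apply: (mulfI x0); rewrite -exprS prednK // xM divff.
apply/eqP => T0.
have [|||z [Pz Qz]] := @common_root_algC K charK P ('X^M - 1) w.
- by rewrite monic_neq0 // monicXnsubC.
- apply/rootP; rewrite PE -[RHS]T0; apply: eq_bigr => i _; apply: eq_bigr => j _.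
  by rewrite !uE invE ?(prim_expr_order wP) // exprVn.
- rewrite rmorphB rmorph1 /= map_polyXn; apply/rootP.
  by rewrite !hornerE (prim_expr_order wP) subrr.
have zM : z ^+ M = 1.
  move/rootP: Qz; rewrite rmorphB rmorph1 /= map_polyXn !hornerE => /eqP.
  by rewrite subr_eq0 => /eqP.
have z1 : `|z| = 1.
  apply/eqP; rewrite -(@Num.Theory.pexpr_eq1 _ _ M) // -Num.Theory.normrX zM.
  by rewrite Num.Theory.normr1.
have zV : z ^+ M.-1 = z^*.
  rewrite invE //; apply: (mulfI (x := z)); first by rewrite -Num.Theory.normr_eq0 z1 oner_eq0.
  rewrite -Num.Theory.normCK z1 expr1n mulfV //.
  by rewrite -Num.Theory.normr_eq0 z1 oner_eq0.
pose A p := \sum_(i | r i == p) z ^+ k i.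
have : \sum_p `|A p| ^+ 2 = 0.
  rewrite -[RHS](rootP Pz) PE [RHS](partition_big r xpredT) //=.
  apply: eq_bigr => p _; rewrite Num.Theory.normCK {1}/A mulr_suml.
  apply: eq_bigr => i /eqP rp; rewrite rmorph_sum mulr_sumr.
  apply: eq_big => [j|j _]; first by rewrite rp eq_sym.
  by rewrite zV rmorphXn.
move/eqP; rewrite Num.Theory.psumr_eq0 => [/allP/(_ (r i0))|p _]; last first.
  by rewrite Num.Theory.exprn_ge0 ?Num.Theory.normr_ge0.
rewrite mem_index_enum => /(_ isT); rewrite expf_eq0 Num.Theory.normr_eq0 /A.
rewrite (eq_bigl (xpred1 i0)) => [|i]; last first.
  by apply/eqP/eqP => [/i0P|->].
rewrite big_pred1_eq expf_eq0 -Num.Theory.normr_eq0 z1 oner_eq0.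
by rewrite andbF.
Qed.

(** Between primitive idempotents of a semisimple algebra, every nonzero element of
    e H f is invertible: this is Schur's lemma for H e and H f. *)
Lemma corner_inverse (K : fieldType) (H : falgType K)
    (ssH : semisimple_algebra H) (e f z : H) :
    e * e = e -> f * f = f -> e * z = z -> z * f = z -> z != 0 ->
    (forall x, exists k, e * x * e = k *: e) ->
    (forall x, exists k, f * x * f = k *: f) ->
  exists y, [/\ z * y = e, y * z = f & f * y * e = y].
Proof.
move=> ee ff ez zf z0 pe pf; have [h zhz] := von_neumann_regular ssH z.
pose y := f * h * e; have fy : f * y = y by rewrite /y !mulrA ff.
have ye : y * e = y by rewrite /y -!mulrA ee.
have zyz : z * y * z = z by rewrite /y !mulrA zf -[_ * e * z]mulrA ez.
exists y; split; last by rewrite fy.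
  have [k Ek] := pe (z * y); have zyk : z * y = k *: e.
    by rewrite -Ek mulrA ez -mulrA ye.
  have /eqP : (k - 1) *: z = 0.
    by rewrite scalerBl scale1r -{2}zyz zyk -scalerAl ez subrr.
  by rewrite scaler_eq0 (negPf z0) orbF subr_eq0 zyk => /eqP->; rewrite scale1r.
have [k Ek] := pf (y * z); have yzk : y * z = k *: f.
  by rewrite -Ek mulrA fy -mulrA zf.
have /eqP : (k - 1) *: z = 0.
  by rewrite scalerBl scale1r -{2}zyz -mulrA yzk -scalerAr zf subrr.
by rewrite scaler_eq0 (negPf z0) orbF subr_eq0 yzk => /eqP->; rewrite scale1r.
Qed.

(** The hypotheses on eps and Lam say that the trivial module is a direct factor of
    H of multiplicity one. *)
Section TraceInner.
Variables (K : closedFieldType) (H : falgType K).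
Hypothesis charK : [pchar K] =i pred0.
Hypothesis ssH : semisimple_algebra H.
Variables (s : {linear H -> H}) (v : H) (M : nat).
Hypothesis sM : forall x y, s (x * y) = s x * s y.
Hypothesis s1 : s 1 = 1.
Hypothesis M0 : (0 < M)%N.
Hypothesis sMK : forall x, iter M s x = x.
Hypothesis vs : forall y, v * y = s y * v.
Hypothesis sv : s v = v.
Hypothesis vreg : forall y, v * y = 0 -> y = 0.
Variables (eps : {scalar H}) (Lam : H).
Hypothesis epsM : forall x y, eps (x * y) = eps x * eps y.
Hypothesis eps1 : eps 1 = 1.
Hypothesis Ll : forall h, h * Lam = eps h *: Lam.
Hypothesis Lr : forall h, Lam * h = eps h *: Lam.
Hypothesis Leps : eps Lam = 1.
Local Notation b i := (vbasis {:H})`_i.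
Local Notation n := (\dim {:H}).

(** Along the Peirce decomposition of H given by s-fixed primitive idempotents, s
    acts on a nonzero e_i H e_j, a line, as w_i / w_j, where v e_i = w_i e_i. *)
Lemma tr_inner_neq0 : tr s != 0.
Proof.
have [es [sum_es ues oes Pes]] := primitive_decomposition charK ssH sM M0 sMK vs sv vreg
  (mulr1 1) s1 (oner_neq0 H).
pose I := 'I_(size es); pose e (i : I) := es`_i.
have Ie i : e i \in es by exact: mem_nth.
have ee i : e i * e i = e i by have [] := Pes _ (Ie i).
have se i : s (e i) = e i by have [] := Pes _ (Ie i).
have e0 i : e i != 0 by have [] := Pes _ (Ie i).
have eP i x : exists k, e i * x * e i = k *: e i.
  by have [_ _ _ /primitive_idemP] := Pes _ (Ie i).
have eo i j : i != j -> e i * e j = 0.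
  by move=> ij; apply: oes => //; rewrite nth_uniq.
have sume : \sum_i e i = 1 by rewrite -[RHS]sum_es (big_nth 0) big_mkord.
have [w wP] : exists w : I -> K, forall i, v * e i = w i *: e i.
  suff [w wP] : exists w : {ffun I -> K}, forall i, v * e i == w i *: e i.
    by exists w => i; apply/eqP.
  have W i : {k : K | v * e i == k *: e i}.
    apply: sigW; have [k Ek] := eP i v; exists k; apply/eqP.
    by rewrite -Ek -{1}(ee i) mulrA vs se.
  by exists [ffun i => sval (W i)] => i; rewrite ffunE; case: (W i).
have w0 i : w i != 0.
  by apply: contra (e0 i) => /eqP wi; apply/eqP/vreg; rewrite wP wi scale0r.
have sE i j y : e i * s y * e j = (w i / w j) *: (e i * y * e j).
  apply: (scalerI (w0 j)); rewrite scalerA mulrC divfK // scalerAr -wP.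
  rewrite !scalerAl -wP mulrA -[e i * s y * v]mulrA -vs !mulrA.
  by rewrite -[in LHS](se i) -vs.
pose rel i j := [exists k : 'I_n, e i * b k * e j != 0].
have relP i j : reflect (exists x, e i * x * e j != 0) (rel i j).
  apply: (iffP existsP) => [[k]|[x]]; first by exists (b k).
  move=> x0; apply/existsP; apply: contraR x0; rewrite negb_exists => /forallP nz.
  rewrite (basis_sum x) mulr_sumr mulr_suml big1 // => k _.
  by have /negPn/eqP := nz k; rewrite -scalerAr -scalerAl => ->; rewrite scaler0.
have relI i j x : e i * x * e j != 0 -> exists y,
   [/\ e i * x * e j * y = e i, y * (e i * x * e j) = e j & e j * y * e i = y].
  by move=> z0; apply: corner_inverse; rewrite ?mulrA ?ee // -!mulrA ee.
have rel_refl i : rel i i by apply/relP; exists 1; rewrite mulr1 ee.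
have rel_sym i j : rel i j -> rel j i.
  move=> /relP[x /relI[y [xy yx ey]]]; apply/relP; exists y; rewrite ey.
  by apply: contra (e0 i) => /eqP y0; rewrite -xy y0 mulr0.
have rel_trans i j k : rel i j -> rel j k -> rel i k.
  move=> /relP[x /relI[y [xy yx ey]]] /relP[x' x'0]; apply/relP.
  exists (x * e j * x'); apply: contra x'0 => /eqP z0; apply/eqP.
  rewrite -yx -[RHS](mulr0 y) -z0.
  by rewrite !mulrA.
(* r picks a representative of each class of isomorphic modules H e_i. *)
pose r i := odflt i [pick j | rel i j].
have rel_r i : rel i (r i).
  by rewrite /r; case: pickP => //= _; exact: rel_refl.
have r_eq i j : (r i == r j) = rel i j.
  apply/eqP/idP => [rij|ij].
    by apply: (rel_trans _ (r i)) => //; rewrite rij; exact: rel_sym.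
  rewrite /r (@eq_pick _ _ (rel j)) => [|k]; last first.
    by apply/idP/idP; apply: rel_trans => //; exact: rel_sym.
  by case: pickP => //= /(_ j); rewrite rel_refl.
have wM i j : rel i j -> (w i / w j) ^+ M = 1.
  move=> /relP[x x0]; set z := e i * x * e j in x0.
  have ez : e i * z * e j = z by rewrite /z !mulrA ee -!mulrA ee.
  have sz : s z = (w i / w j) *: z by rewrite -{2}ez -sE -{1}ez !sM !se.
  have it k : iter k s z = (w i / w j) ^+ k *: z.
    by elim: k => [|k IHk]; rewrite ?scale1r // iterS IHk linearZ /= sz scalerA exprSr.
  have /eqP : ((w i / w j) ^+ M - 1) *: z = 0 by rewrite scalerBl -it sMK scale1r subrr.
  by rewrite scaler_eq0 (negPf x0) orbF subr_eq0 => /eqP.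
(* Dividing by the value at the representative turns the w_i into roots of unity
   without changing the quotients within a class. *)
pose u i := w i / w (r i).
have trE i j : tr (fun y => e i * s y * e j) = if r i == r j then u i / u j else 0.
  rewrite (eq_tr (sE i j)) trZ r_eq; case: ifP => [ij|nij]; last first.
    rewrite (eq_tr (G := fun=> 0)) => [|y].
      by rewrite /tr big1 ?mulr0 // => k _; rewrite linear0.
    by apply/eqP/negPn/negP => y0; case/relP: nij; exists y.
  have rij : r i = r j by apply/eqP; rewrite r_eq.
  have ->: u i / u j = w i / w j.
    by rewrite /u rij invf_div mulrA divfK.
  rewrite -[RHS]mulr1; congr (_ * _).
  have /relP[x /[dup] x0 /relI[x' [xx' x'x ex']]] := ij.
  set z := e i * x * e j in x0 xx' x'x.
  have [k zk] : exists k, coord (vbasis {:H}) k z != 0.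
    have [k zk|z0] := pickP (fun k : 'I_n => coord (vbasis {:H}) k z != 0); first by exists k.
    case/eqP: x0; rewrite (basis_sum z) big1 // => k _.
    by have /negbFE/eqP -> := z0 k; rewrite scale0r.
  pose ph y := coord (vbasis {:H}) k (e i * y * e j) / coord (vbasis {:H}) k z.
  have phE y : e i * y * e j = ph y *: z.
    have [a Ea] := eP i (y * x').
    have Ey : e i * y * e j = a *: z.
      have ez : e i * z = z by rewrite /z !mulrA ee.
      by rewrite -{1}x'x mulrA -[e i * y * x']mulrA -{1}ez mulrA Ea -scalerAl ez.
    by rewrite {1}Ey /ph Ey linearZ /= mulfK.
  have phl : scalar ph by rewrite /ph; lin.
  rewrite (eq_tr phE) tr_rank1 // /ph.
  by rewrite (_ : e i * z * e j = z) ?divff // /z !mulrA ee -!mulrA ee.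
have [i0 Li0] : exists i0, eps (e i0) = 1.
  have [i ei|e00] := pickP (fun i => eps (e i) != 0).
    by exists i; apply: (mulfI ei); rewrite -epsM ee mulr1.
  have := oner_neq0 K; rewrite -eps1 -sume linear_sum big1 ?eqxx // => i _.
  by have /negbFE/eqP := e00 i.
(* e_(i0) is a multiple of Lam, which is central and spans a one-dimensional
   ideal, so no other e_i is linked to it. *)
have sing i : r i = r i0 -> i = i0.
  move=> /esym/eqP; rewrite r_eq => /relP[x x0].
  have [k Ek] := eP i0 Lam; have Lk : Lam = k *: e i0.
    by rewrite -Ek Ll Li0 scale1r Lr Li0 scale1r.
  have k0 : k != 0.
    by apply/eqP => k0; have := oner_neq0 K; rewrite -Leps Lk k0 scale0r linear0 eqxx.
  apply/eqP; apply: contraR x0 => /eqP/eqP; rewrite eq_sym => /eo ei.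
  have: k *: (e i0 * x * e i) = 0.
    by rewrite scalerAl scalerAl -Lk Lr -scalerAl Lk -scalerAl ei !scaler0.
  by move/eqP; rewrite scaler_eq0 (negPf k0).
have uM i : u i ^+ M = 1 by exact: wM.
suff ->: tr s = \sum_i \sum_(j | r i == r j) u i / u j.
  exact: (sum_unity_roots_neq0 charK M0 uM sing).
rewrite (eq_tr (G := fun y => \sum_i \sum_j e i * s y * e j)) => [|y].
  rewrite tr_sum; apply: eq_bigr => i _; rewrite tr_sum [RHS]big_mkcond.
  by apply: eq_bigr => j _; rewrite trE.
rewrite -{1}[s y]mul1r -{1}[1 * s y]mulr1 -sume !mulr_suml; apply: eq_bigr => i _.
by rewrite mulr_sumr.
Qed.

End TraceInner.

(** * The squared antipode is the identity *)

Lemma natr_inj_char0 (K : fieldType) (charK : [pchar K] =i pred0) (a c : nat) :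
  a%:R = c%:R :> K -> a = c.
Proof.
wlog ac : a c / (a <= c)%N.
  by move=> W; case/orP: (leq_total a c) => [/W//|ca /esym/(W _ _ ca)].
move=> E; apply/eqP; rewrite eqn_leq ac /= -subn_eq0 -((pcharf0P K).1 charK).
by rewrite natrB // E subrr.
Qed.

Section CharacterElement.
Variables (K : fieldType) (H : falgType K) (S : hopf_structure H).
Local Notation eps := (counit S).
Local Notation sS := (antipode S).
Local Notation sw := (sweedler S).
Local Notation sg := (antipode2 S).
Local Notation b i := (vbasis {:H})`_i.
Local Notation c i := (coord (vbasis {:H}) i).
Local Notation n := (\dim {:H}).

(** The regular character of the dual algebra, as an element of H. *)
Definition regchar : H := \sum_(i < n) sw (fun p q => c i q *: p) (b i).

Lemma map_regchar (W : lmodType K) (f : H -> W) : linear f ->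
  f regchar = \sum_(i < n) sw (fun p q => c i q *: f p) (b i).
Proof.
move=> fl; rewrite lin_sum //; apply: eq_bigr => i _.
by rewrite sw_map //; apply: eq_sw => p q; rewrite linZ.
Qed.

Lemma regchar_lam (lam : {scalar H}) :
    (forall h, sw (fun x y => lam x *: y) h = (lam h)%:A) ->
  lam regchar = lam 1.
Proof.
move=> lamR; rewrite (@map_regchar K^o (lam : H -> K^o)); last exact: linearP.
rewrite [in RHS](basis_sum 1) linear_sum; apply: eq_bigr => i _.
transitivity (c i (sw (fun p q => lam p *: q) (b i))).
  rewrite (@sw_map _ _ S _ K^o (c i)); last exact: linearP.
  by apply: (@eq_sw _ _ S K^o) => p q; rewrite linearZ; exact: mulrC.
by rewrite lamR linearZ linearZ /=; exact: mulrC.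
Qed.

Lemma eps_regchar : eps regchar = n%:R.
Proof.
rewrite (@map_regchar K^o (eps : H -> K^o)); last exact: linearP.
rewrite (eq_bigr (fun=> 1)) ?sumr_const ?card_ord // => i _.
transitivity (c i (sw (fun p q => eps p *: q) (b i))).
  rewrite (@sw_map _ _ S _ K^o (c i)); last exact: linearP.
  by apply: (@eq_sw _ _ S K^o) => p q; rewrite linearZ; exact: mulrC.
by rewrite (sw_epsl S (f := id)) // coord_b eqxx.
Qed.

(** Cyclicity of a trace with coefficients in H: in x1 ⊗ x2 the second factor is
    traced, the first one is the coefficient. *)
Lemma trace_coaction_cyclic (F G : H -> H) : linear F -> linear G ->
  \sum_(i < n) sw (fun p q => c i (F q) *: p) (G (b i)) =
  \sum_(k < n) sw (fun p q => c k (G (F q)) *: p) (b k).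
Proof.
move=> Fl Gl.
transitivity (\sum_(i < n) \sum_(k < n) sw (fun p q =>
    (c k (G (b i)) * c i (F q)) *: p) (b k)).
  apply: eq_bigr => i _; rewrite -(resum (f := sw (fun p q => c i (F q) *: p)));
    last by lin.
  by apply: eq_bigr => k _; rewrite -swZ; apply: eq_sw => p q; rewrite scalerA.
rewrite exchange_big; apply: eq_bigr => k _; rewrite -sw_sum; apply: eq_sw => p q.
rewrite -scaler_suml; congr (_ *: _).
rewrite [in RHS](basis_sum (F q)) lin_sum // linear_sum; apply: eq_bigr => i _.
by rewrite linZ // linearZ mulrC.
Qed.

(** A character is a trace function on the dual algebra. *)
Lemma regchar_cocomm (W : vectType K) (f : H -> H -> W) :
    (forall y, linear (fun x => f x y)) -> (forall x, linear (f x)) ->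
  sw f regchar = sw (fun p q => f q p) regchar.
Proof.
move=> f1 f2; have fl : linear (sw f) by lin.
have fl' : linear (sw (fun p q => f q p)) by lin.
rewrite !map_regchar //.
pose A i k := sw (fun u t => sw (fun w q => (c k t * c i q) *: f u w) (b k)) (b i).
transitivity (\sum_(i < n) \sum_(k < n) A i k).
  apply: eq_bigr => i _.
  transitivity (sw (fun t q => sw (fun u w => c i q *: f u w) t) (b i)).
    by apply: eq_sw => t q; rewrite swZ.
  rewrite (sw_assoc S (f := fun u w q => c i q *: f u w)); try lin.
  rewrite -sw_sum; apply: eq_sw => u t.
  rewrite -(resum (f := sw (fun w q => c i q *: f u w))); last by lin.
  by apply: eq_bigr => k _; rewrite -swZ; apply: eq_sw => w q; rewrite scalerA.
rewrite exchange_big; apply: eq_bigr => k _ /=.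
transitivity (sw (fun w r => sw (fun u t => c k t *: f u w) r) (b k)).
  rewrite /A (eq_bigr _ (fun i _ => sw_comm S _ _ _)) -sw_sum.
  apply: eq_sw => w q.
  rewrite -(resum (f := sw (fun u t => c k t *: f u w))); last by lin.
  apply: eq_bigr => i _; rewrite -swZ; apply: eq_sw => u t.
  by rewrite scalerA mulrC.
rewrite -(sw_assoc S (f := fun w u t => c k t *: f u w)); try lin.
by apply: eq_sw => t q; rewrite swZ.
Qed.

(** Rewrite a1 y ⊗ a2 as (a y1)_1 ⊗ (a y1)_2 S(y2) and use the cyclicity of the
    trace to collect the antipode and y1 in one factor S(y2) y1. *)
Lemma regchar_mul y :
  regchar * y = sw (fun y1 y2 =>
    \sum_(k < n) sw (fun p q => c k (q * (sS y2 * y1)) *: p) (b k)) y.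
Proof.
rewrite (map_regchar (f := fun x => x * y)); last by lin.
transitivity (sw (fun y1 y2 => \sum_(i < n)
   sw (fun p q => c i (q * sS y2) *: p) (b i * y1)) y); last first.
  apply: eq_sw => y1 y2.
  rewrite (trace_coaction_cyclic (F := fun q => q * sS y2) (G := fun x => x * y1));
    try lin.
  by apply: eq_bigr => k _; apply: eq_sw => p q; rewrite mulrA.
rewrite sw_sum; apply: eq_bigr => i _.
transitivity (sw (fun t y3 => sw (fun y1 y2 => sw (fun p q =>
    c i (q * (y2 * sS y3)) *: (p * y1)) (b i)) t) y); last first.
  apply: eq_sw => t y3; rewrite sw_comm [RHS]sw_mul; try lin.
  by apply: eq_sw => p q; apply: eq_sw => y1 y2; rewrite mulrA.
rewrite (sw_assoc S (f := fun y1 y2 y3 => sw (fun p q =>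
    c i (q * (y2 * sS y3)) *: (p * y1)) (b i))); try lin.
transitivity (sw (fun y1 t => eps t *: sw (fun p q => c i q *: (p * y1)) (b i)) y).
  by rewrite sw_epsr //; lin.
apply: eq_sw => y1 t.
rewrite (sw_antir S (f := fun z => sw (fun p q => c i (q * z) *: (p * y1)) (b i)));
  last by lin.
by congr (_ *: _); apply: eq_sw => p q; rewrite mulr1.
Qed.

(** A module tensored with the regular module is free.  In regchar_mul with
    y = regchar, cocommutativity turns S(y2) y1 into S(y1) y2 = eps(y) = n. *)
Lemma regchar2 : regchar * regchar = n%:R *: regchar.
Proof.
pose phi z := \sum_(k < n) sw (fun p q => c k (q * z) *: p) (b k).
have pl : linear phi by apply: lin_suml => k; lin.
rewrite regchar_mul -/(phi _) (regchar_cocomm (f := fun y1 y2 => phi (sS y2 * y1)));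
  try lin.
rewrite (sw_antil S _ pl) eps_regchar; congr (_ *: _).
by apply: eq_bigr => k _; apply: eq_sw => p q; rewrite mulr1.
Qed.

Lemma antipode2_regchar : (forall z, sg (sg z) = z) -> sg regchar = regchar.
Proof.
move=> sg2; rewrite map_regchar; last by lin.
transitivity (\sum_(i < n) sw (fun p q => c i (sg q) *: p) (sg (b i))).
  apply: eq_bigr => i _; rewrite sw_antipode2; try lin.
  by apply: eq_sw => p q; rewrite sg2.
rewrite (trace_coaction_cyclic (F := sg) (G := sg)); try lin.
by apply: eq_bigr => k _; apply: eq_sw => p q; rewrite sg2.
Qed.

End CharacterElement.

(** C is the difference of the projections on the eigenspaces of 1 and -1. *)
Lemma tr_cube (K : fieldType) (charK : [pchar K] =i pred0) (V : vectType K)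
    (C : V -> V) : linear C -> (forall x, C (C (C x)) = C x) ->
  exists r1 r2 : nat, tr C = r1%:R - r2%:R.
Proof.
move=> Cl C3; have two0 : 2%:R != 0 :> K by rewrite (pcharf0P K).1.
have CD x y : C (x + y) = C x + C y by have := Cl 1 x y; rewrite !scale1r.
have CN x : C (- x) = - C x by rewrite -scaleN1r linZ // scaleN1r.
pose P x := 2%:R^-1 *: (C (C x) + C x).
pose Q x := 2%:R^-1 *: (C (C x) - C x).
have Pl : linear P.
  move=> a x y; rewrite /P !Cl addrACA -scalerDr [LHS](scalerDr _ (a *: _)).
  by rewrite !scalerA mulrC.
have Ql : linear Q.
  move=> a x y; rewrite /Q !Cl opprD addrACA -scalerBr [LHS](scalerDr _ (a *: _)).
  by rewrite !scalerA mulrC.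
have half (x : V) : 2%:R^-1 *: (x + x) = x.
  by rewrite -mulr2n -[x *+ 2]scaler_nat scalerA mulVf // scale1r.
have PP x : P (P x) = P x.
  rewrite /P !(linZ _ _ Cl) -scalerDr !CD !C3 [C x + _]addrC; congr (_ *: _).
  exact: half.
have QQ x : Q (Q x) = Q x.
  rewrite /Q !(linZ _ _ Cl) -scalerBr !CD !CN !C3; congr (_ *: _).
  by rewrite opprB; exact: half.
have [r1 E1 _] := tr_idem Pl PP; have [r2 E2 _] := tr_idem Ql QQ.
exists r1, r2; rewrite -E1 -E2 -trB; apply: eq_tr => x.
by rewrite /P /Q -scalerBr opprB [X in _ *: X]addrC addrA subrK half.
Qed.

Section SquareOfAntipode.
Variables (K : closedFieldType) (charK : [pchar K] =i pred0).
Variables (H : falgType K) (S : hopf_structure H) (ssH : semisimple_algebra H).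
Local Notation eps := (counit S).
Local Notation sS := (antipode S).
Local Notation sw := (sweedler S).
Local Notation sg := (antipode2 S).
Local Notation n := (\dim {:H}).

(** If f is a left integral then S(f) is a right one, and the two must agree since
    S(f) f = f = S(f) when both have counit 1. *)
Lemma unimodular : exists Lam : H,
  [/\ integral S Lam, eps Lam = 1 & sS Lam = Lam].
Proof.
have [f f1 lf] := left_integral1 S ssH.
have lamf : trace_form S f = 1 by rewrite (trace_form_integral lf).
have Ssurj y : exists x, sS x = y.
  by eexists; exact: (anti_surj lf (trace_form_rint S) lamf).
have rSf h : sS f * h = eps h *: sS f.
  by have [x <-] := Ssurj h; rewrite -antiM lf linearZ eps_anti.
have Sf : sS f = f.
  by rewrite -[LHS]scale1r -f1 -rSf lf eps_anti f1 scale1r.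
by exists f; split=> // h; split; rewrite ?lf // -{1}Sf rSf Sf.
Qed.

Theorem square_antipode h : sS (sS h) = h.
Proof.
have [Lam [intL e1 SL]] := unimodular.
have lL x : x * Lam = eps x *: Lam by have [] := intL x.
have rL x : Lam * x = eps x *: Lam by have [] := intL x.
pose lam : {scalar H} := trace_form S.
have lamR := trace_form_rint S : forall h, sw (fun x y => lam x *: y) h = (lam h)%:A.
have lamL : lam Lam = 1 by rewrite -e1 -(trace_form_integral lL).
have [M M0 sMK] := antipode2_finite_order intL lamR lamL.
have T0 : tr sg != 0.
  have vreg := twist_elt_reg intL lamR lamL charK ssH.
  exact: (@tr_inner_neq0 K H charK ssH sg (twist_elt S Lam) M (antipode2M S)
    (antipode2_1 S) M0 sMK (twist_elt_comm intL) (antipode2_twist_elt SL) vreg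
    eps Lam (counitM S) (counit1 S) lL rL e1).
have lam1 : lam 1 = tr sg by exact: trace_form1.
have g1 : dist_grouplike S Lam lam = 1.
  have := lam_grouplike intL lamR lamL 1; rewrite sw1; try lin.
  by rewrite lam1 => /(scalerI T0).
have sg2 z : sg (sg z) = z.
  by have := radford intL lamR lamL z; rewrite g1 mulr1 mul1r.
have n_gt0 : (0 < n)%N.
  rewrite lt0n dimv_eq0; apply/eqP => f0.
  by have := memvf (1 : H); rewrite f0 memv0 oner_eq0.
have n0 : n%:R != 0 :> K by rewrite (pcharf0P K).1 // -lt0n.
(* tr B = lam(X) = lam(1) = tr S^2, while B / n is the difference of two
   projections, so that tr S^2 is n times an integer. *)
pose X := regchar S; pose B x := sg x * X.
have Bl : linear B by rewrite /B; lin.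
have tr_B : tr B = tr sg by rewrite -lam1 -(regchar_lam lamR).
pose C x := n%:R^-1 *: B x.
have Cl : linear C by apply: lin_scaler.
have XX : X * X = n%:R *: X by exact: regchar2.
have sX : sg X = X by exact: antipode2_regchar.
have C3 x : C (C (C x)) = C x.
  rewrite /C !(linZ _ _ Bl) /B; congr (_ *: _).
  rewrite !antipode2M !sg2 !sX -!mulrA XX -!scalerAr XX -scalerAr !scalerA.
  by rewrite mulrA mulfVK // mulVf // scale1r.
have [r1 [r2 trC]] := tr_cube charK Cl C3.
have two0 : 2%:R != 0 :> K by rewrite (pcharf0P K).1.
(* The projection on the eigenspace of -1. *)
pose P x := 2%:R^-1 *: (x - sg x).
have Pl : linear P.
  move=> a x y; rewrite /P linearP opprD addrACA -scalerBr.
  by rewrite [LHS](scalerDr _ (a *: _)) !scalerA mulrC.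
have PP x : P (P x) = P x.
  rewrite /P [sg (_ *: _)]linearZ_LR -scalerBr [sg (x - _)]linearB sg2.
  congr (_ *: _); rewrite opprB -mulr2n -[X in _ *: X]scaler_nat scalerA mulVf //.
  by rewrite scale1r.
have [m trP [mn m0 mm]] := tr_idem Pl PP.
have E : n%:R - tr sg = 2%:R * m%:R.
  by rewrite -trP /P trZ trB tr_id mulrA mulfV // mul1r.
have TE : tr sg = n%:R * (r1%:R - r2%:R) by rewrite -trC /C trZ tr_B mulVKf.
(* n - 2m = n (r1 - r2), written without subtraction. *)
have eqn : (n + n * r2 = m + m + n * r1)%N.
  apply: (natr_inj_char0 charK); rewrite !natrD !natrM.
  rewrite mulr_natl mulr2n in E; rewrite -E TE.
  rewrite mulrBr opprB.
  by rewrite addrA subrK.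
have r12 : r1 != r2.
  by apply: contra T0 => /eqP r12; rewrite TE r12 subrr mulr0.
have [m_0|m_n] : m = 0%N \/ m = n.
  suff arith N : (m <= N)%N -> (N + N * r2 = m + m + N * r1)%N -> m = 0%N \/ m = N.
    exact: arith mn eqn.
  move: (r1) (r2) (m) r12 => {n_gt0 n0 mn m0 mm E TE eqn trP trC m r1 r2} r1 r2 m.
  case: (ltngtP r1 r2) => // r12 _ mn eqn; [right | left].
    have nr : (N * r1 + N <= N * r2)%N by rewrite -mulnSr leq_mul2l r12 orbT.
    by lia.
  have nr : (N * r2 + N <= N * r1)%N by rewrite -mulnSr leq_mul2l r12 orbT.
  by lia.
  have /eqP := m0 m_0 h.
  by rewrite scaler_eq0 invr_eq0 (negPf two0) subr_eq0 => /eqP.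
have := mm m_n 1; rewrite /P antipode2_1 subrr scaler0 => /eqP.
by rewrite eq_sym oner_eq0.
Qed.

End SquareOfAntipode.

(** * Integrality and divisibility *)

Section AlgebraicIntegers.
Variable K : fieldType.
Local Notation Aint := (@algebraic_integer K).
Local Notation zK := (intmul 1 : int -> K).

Lemma Aint0 : Aint 0. Proof. exact: (@integral0 _ _ zK). Qed.
Lemma Aint1 : Aint 1. Proof. exact: (@integral1 _ _ zK). Qed.
Lemma AintN x : Aint x -> Aint (- x).
Proof. exact: (@integral_opp _ _ zK). Qed.
Lemma AintD x y : Aint x -> Aint y -> Aint (x + y).
Proof. exact: (@integral_add _ _ zK). Qed.
Lemma AintM x y : Aint x -> Aint y -> Aint (x * y).
Proof. exact: (@integral_mul _ _ zK). Qed.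

Lemma Aint_sum I (r : seq I) (P : pred I) (F : I -> K) :
  (forall i, Aint (F i)) -> Aint (\sum_(i <- r | P i) F i).
Proof. by move=> AF; elim/big_ind: _ => //; [exact: Aint0 | exact: AintD]. Qed.

Let Apoly (p : {poly K}) := forall i, Aint p`_i.

Let ApolyM p q : Apoly p -> Apoly q -> Apoly (p * q).
Proof. by move=> Ap Aq i; rewrite coefM; apply: Aint_sum => j; apply: AintM. Qed.

(** Algebraic integers are closed under the sums and products of the determinant
    that defines the characteristic polynomial. *)
Lemma char_poly_Aint m (A : 'M[K]_m) :
  (forall i j, Aint (A i j)) -> forall k, Aint (char_poly A)`_k.
Proof.
move=> AA; rewrite -/(Apoly _) /char_poly /determinant.
have A1 : Apoly 1.
  by move=> i; rewrite coef1; case: (i == 0)%N; [exact: Aint1 | exact: Aint0].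
elim/big_ind: _ => [i|p q Ap Aq i|s _].
- by rewrite coef0; exact: Aint0.
- by rewrite coefD; exact: AintD.
apply: ApolyM; first by case: (odd_perm s) => // i; rewrite expr1 coefN; exact/AintN/A1.
elim/big_ind: _ => // i _.
move=> k; rewrite !mxE coefB coefC coefMn coefX; apply: AintD.
  case: (i == s i); last exact: Aint0.
  by case: (k == 1)%N; [exact: Aint1 | exact: Aint0].
by apply: AintN; case: (k == 0)%N; [exact: AA | exact: Aint0].
Qed.

Lemma Aint_eigenvalue (T : finType) (A : T -> T -> K) (y : T -> K) (q : K) t0 :
    (forall s t, Aint (A s t)) -> y t0 != 0 ->
    (forall s, \sum_t A s t * y t = q * y s) -> Aint q.
Proof.
move=> AA y0 Ay.
pose B : 'M[K]_#|T| := \matrix_(i, j) A (enum_val j) (enum_val i).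
have rq : root (char_poly B) q.
  rewrite -eigenvalue_root_char; apply/eigenvalueP.
  exists (\row_i y (enum_val i)); last first.
    apply/eqP => /rowP/(_ (enum_rank t0)); rewrite !mxE enum_rankK => y00.
    by rewrite y00 eqxx in y0.
  apply/rowP => j; rewrite !mxE -Ay [RHS](reindex_onto enum_val enum_rank) /=; last first.
    by move=> t _; rewrite enum_rankK.
  apply: eq_big => [i|i _]; first by rewrite enum_valK eqxx.
  by rewrite !mxE mulrC.
apply: (@integral_root_monic _ _ zK _ _ (char_poly_monic B) rq) => x.
case/(nthP 0) => k _ <-; apply: char_poly_Aint => i j.
by rewrite mxE.
Qed.

(** A common root in algC of the equation of integral dependence and of d X - m is
    the rational number m / d, now among the complex algebraic integers. *)
Lemma Aint_quotient (charK : [pchar K] =i pred0) (m d : nat) (q : K) :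
  (0 < d)%N -> d%:R * q = m%:R -> Aint q -> (d %| m)%N.
Proof.
move=> d0 dq [p pm pq].
pose Q : {poly int} := d%:R *: 'X - m%:R%:P.
have QE (R : fieldType) : map_poly (intr : int -> R) Q = d%:R *: 'X - m%:R%:P.
  by rewrite rmorphB /= map_polyZ map_polyX map_polyC /= !rmorph_nat.
have d0' : d%:R != 0 :> algC by rewrite Num.Theory.pnatr_eq0 -lt0n.
have [||z [pz]] := @common_root_algC K charK p Q q _ pq.
- have := d0'; apply: contra => /eqP Q0; have := QE algC.
  rewrite Q0 rmorph0 => /(congr1 (fun r : {poly algC} => r`_1)).
  by rewrite coef0 coefB coefZ coefX coefC subr0 mulr1 => <-.
- by rewrite QE; apply/rootP; rewrite !hornerE dq subrr.
rewrite QE => /rootP; rewrite !hornerE => /eqP; rewrite subr_eq0 => /eqP dz.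
have zE : z = m%:R / d%:R by rewrite -dz mulrC mulKf.
have : z \is a Num.int.
  apply: Cint_rat_Aint; first by rewrite zE rpred_div ?rpred_nat.
  apply: (root_monic_Aint pz); first exact: monic_map.
  by apply/polyOverP => i; rewrite coef_map /= Num.Theory.intr_int.
case/Num.Theory.intrP => a za.
have : (m%:Z = a * d%:Z).
  by apply: (@intr_inj algC); rewrite rmorphM /= -za zE divfK.
by move=> /(congr1 absz); rewrite abszM !absz_nat => ->; rewrite dvdn_mull.
Qed.

End AlgebraicIntegers.

Section Module.
Variables (K : closedFieldType) (charK : [pchar K] =i pred0).
Variables (H : falgType K) (S : hopf_structure H).
Variables (V : vectType K) (act : H -> V -> V).
Hypothesis actl : forall u, linear (fun h => act h u).
Hypothesis actr : forall h, linear (act h).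
Hypothesis act1 : forall u, act 1 u = u.
Hypothesis actM : forall h k u, act (h * k) u = act h (act k u).
Hypothesis irr : forall U : {vspace V},
  (forall h u, u \in U -> act h u \in U) -> U = 0%VS \/ U = fullv.
Hypothesis V0 : (0 < \dim {:V})%N.
Hypothesis S2 : forall h, antipode S (antipode S h) = h.
Variables (Lam : H) (lL : forall h, h * Lam = counit S h *: Lam).
Local Notation sw := (sweedler S).
Local Notation sS := (antipode S).
Local Notation eps := (counit S).

(** Schur's lemma: an eigenspace of phi is a submodule. *)
Lemma irreducible_commutant (phi : V -> V) : linear phi ->
    (forall h u, phi (act h u) = act h (phi u)) ->
  exists c, forall u, phi u = c *: u.
Proof.
move=> pl pa.
have [||c [x [_ x0 px]]] := eigenvector_in (U := fullv) pl.
- by rewrite -dimv_eq0 -lt0n.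
- by move=> u _; exact: memvf.
exists c => u.
pose psi u := phi u - c *: u.
have psil : linear psi.
  move=> a v w; rewrite /psi pl [c *: (_ + _)]scalerDr opprD addrACA.
  by rewrite scalerBr !scalerA mulrC.
pose g := GRing.isLinear.Build K V V _ psi psil.
pose G : {linear V -> V} := HB.pack psi g.
pose U := lker (linfun G).
have UE w : (w \in U) = (phi w == c *: w) by rewrite memv_ker lfunE /= subr_eq0.
have [h w|U0|U1] := @irr U.
- by rewrite !UE pa => /eqP ->; rewrite linZ.
- by have := UE x; rewrite U0 memv0 px eqxx (negPf x0).
- by apply/eqP; rewrite -UE U1 memvf.
Qed.

(** The hypothesis S^2 = id is essential here: S maps S(Lam1) Lam2 to
    S(Lam2) S^2(Lam1). *)
Lemma sw_anti_swap : sw (fun a c => sS c * a) Lam = (eps Lam)%:A.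
Proof.
transitivity (sS (sw (fun a c => sS a * c) Lam)).
  by rewrite sw_map; [apply: eq_sw => a c; rewrite antiM S2 | lin].
by rewrite swE antipodel linearZ /= anti1.
Qed.

Definition average (phi : V -> V) (u : V) : V :=
  sw (fun a c => act a (phi (act (sS c) u))) Lam.

Lemma average_lin phi : linear phi -> linear (average phi).
Proof. by move=> pl; rewrite /average; lin. Qed.

(** The Casimir property of Lam1 ⊗ S(Lam2). *)
Lemma average_act phi h u : linear phi ->
  average phi (act h u) = act h (average phi u).
Proof.
move=> pl; rewrite /average.
transitivity (sw (fun a c => act a (phi (act (sS c * h) u))) Lam).
  by apply: eq_sw => a c; rewrite actM.
rewrite -(casimir lL (f := fun a c => act a (phi (act c u)))); try lin.
by rewrite sw_map //; apply: eq_sw => a c; rewrite actM.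
Qed.

(** Cyclicity of the trace brings S(Lam2) and Lam1 together. *)
Lemma tr_average phi : linear phi -> tr (average phi) = eps Lam * tr phi.
Proof.
move=> pl; pose psi z : K^o := tr (fun u => phi (act z u)).
have psil : linear psi.
  move=> a x y; rewrite /psi /tr scaler_sumr -big_split; apply: eq_bigr => i _.
  by rewrite actl pl linearP.
transitivity (psi (sw (fun a c => sS c * a) Lam)); last first.
  rewrite sw_anti_swap linZ //; congr (_ * _).
  by apply: eq_tr => u; rewrite act1.
rewrite sw_map // tr_sum; apply: eq_bigr => i _; rewrite tr_sum.
apply: eq_bigr => j _; rewrite trZ; congr (_ * _).
rewrite (trC (F := act _) (G := fun u => phi (act _ u))); try lin.
by apply: eq_tr => u; rewrite actM.
Qed.

(** The average of the rank one map x |-> l(x) v is a scalar, and its trace shows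
    that this scalar is q l(v).  As l and v are arbitrary, this says that
    Lam1 ⊗ S(Lam2) acts on V ⊗ V as q times the flip. *)
Lemma casimir_flip (q : K) (l : V -> K) u v : scalar l ->
    (\dim {:V})%:R * q = eps Lam ->
  sw (fun a c => l (act (sS c) u) *: act a v) Lam = (q * l v) *: u.
Proof.
move=> ll dq; pose phi x := l x *: v.
have pl : linear phi by rewrite /phi; lin.
have [c cE] := irreducible_commutant (average_lin pl) (fun h w => average_act h w pl).
have := tr_average pl; rewrite (eq_tr cE) trZ tr_id (tr_rank1 _ ll) -dq => E.
have {}E : c = q * l v.
  have d0 : (\dim {:V})%:R != 0 :> K by rewrite (pcharf0P K).1 // -lt0n.
  by apply: (mulfI d0); rewrite mulrC E mulrA.
rewrite -E -cE; apply: eq_sw => a c'; by rewrite /phi linZ.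
Qed.

End Module.

(** For a linear form l and a vector v with l(v) = 1, put y_k = l(x_k v).  By
    casimir_flip the family y_k y_k' indexed by pairs is an eigenvector, with
    eigenvalue m / dim V, of the matrix of the multiplication by nu, which is built
    from the products of the coefficients nuc and mult.  As the
    same l is applied to both factors of V ⊗ V, this family is invariant under the
    flip. *)
Lemma frobenius_divisibility (K : closedFieldType) (charK : [pchar K] =i pred0)
    (H : falgType K) (S : hopf_structure H)
    (V : vectType K) (act : H -> V -> V) (Lam : H) (m : nat)
    (T : finType) (x : T -> H) (mult : T -> T -> T -> K) (nuc : T -> T -> K) :
    (forall u, linear (fun h => act h u)) -> (forall h, linear (act h)) ->
    (forall u, act 1 u = u) ->
    (forall h k u, act (h * k) u = act h (act k u)) ->
    (forall U : {vspace V},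
      (forall h u, u \in U -> act h u \in U) -> U = 0%VS \/ U = fullv) ->
    (0 < \dim {:V})%N ->
    (forall h, antipode S (antipode S h) = h) ->
    (forall h, h * Lam = counit S h *: Lam) -> counit S Lam = m%:R ->
    (forall h, exists k : T -> K, h = \sum_i k i *: x i) ->
    (forall i j l, algebraic_integer (mult i j l)) ->
    (forall i j, x i * x j = \sum_l mult i j l *: x l) ->
    (forall i j, algebraic_integer (nuc i j)) ->
    nu S Lam = \sum_i \sum_j nuc i j *: (x i ⊗ x j) ->
  (\dim {:V} %| m)%N.
Proof.
move=> actl actr act1 actM irr V0 S2 lL epsL gen_x Amult multE Anuc nuE.
have d0 : (\dim {:V})%:R != 0 :> K by rewrite (pcharf0P K).1 // -lt0n.
pose q : K := m%:R / (\dim {:V})%:R.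
have dq : (\dim {:V})%:R * q = m%:R by rewrite mulrC divfK.
apply: (Aint_quotient charK V0 dq).
have nu_lift (W : vectType K) (f : H -> H -> W) :
    (forall y, linear (fun x => f x y)) -> (forall x, linear (f x)) ->
    sweedler S (fun a c => f a (antipode S c)) Lam = \sum_i \sum_j nuc i j *: f (x i) (x j).
  move=> f1 f2; have fl : linear (tens_lift f) by exact: tens_lift_is_linear.
  transitivity (tens_lift f (nu S Lam)).
    rewrite /nu /tens_map lift_comp //; apply: lift_ext => a c.
    by rewrite tens_liftE.
  rewrite nuE lin_sum //; apply: eq_bigr => i _; rewrite lin_sum //.
  by apply: eq_bigr => j _; rewrite linZ // tens_liftE.
pose i0 : 'I_(\dim {:V}) := Ordinal V0.
pose v : V := (vbasis {:V})`_i0; pose l u : K := coord (vbasis {:V}) i0 u.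
have ll : scalar l by rewrite /l; lin.
have lv : l v = 1 by rewrite /l coord_b eqxx.
pose y i := l (act (x i) v).
have [t yt] : exists t, y t != 0.
  have [t yt|y0] := pickP (fun t => y t != 0); first by exists t.
  have [k Dk] := gen_x 1; have := oner_neq0 K; rewrite -lv -[v]act1 Dk.
  rewrite (@lin_sum _ _ _ (act^~ v)) // (@lin_sum _ _ K^o l) // big1 ?eqxx // => i _.
  rewrite (@linZ _ _ _ (act^~ v)) // (@linZ _ _ K^o l) //.
  by have /negbFE/eqP E := y0 i; rewrite -/(y i) E scaler0.
pose A (s t : T * T) :=
  \sum_i \sum_j nuc i j * (mult i s.1 t.1 * mult j s.2 t.2).
apply: (@Aint_eigenvalue _ _ A (fun s => y s.1 * y s.2) q (t, t)).
- move=> s s'; apply: Aint_sum => i; apply: Aint_sum => j.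
  by apply: AintM => //; apply: AintM.
- by rewrite mulf_neq0.
have xE i k : l (act (x i) (act (x k) v)) = \sum_p mult i k p * y p.
  rewrite -actM multE (@lin_sum _ _ _ (act^~ v)) // (@lin_sum _ _ K^o l) //.
  apply: eq_bigr => p _.
  by rewrite (@linZ _ _ _ (act^~ v)) // (@linZ _ _ K^o l).
move=> [k k'] /=; have := @casimir_flip _ charK _ S _ _ actl actr act1 actM irr V0 S2 _
  lL q l (act (x k') v) (act (x k) v) ll.
rewrite epsL => /(_ dq).
rewrite (nu_lift _ (fun a c => l (act c (act (x k') v)) *: act a (act (x k) v)));
  try lin.
move/(congr1 l); rewrite (@linZ _ _ K^o l) // -[_ *: _]/(_ * _) -mulrA -/(y k) -/(y k') => <-.
rewrite (@lin_sum _ _ K^o l) //.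
transitivity (\sum_i \sum_j \sum_(s : T * T)
   nuc i j * (mult i k s.1 * mult j k' s.2) * (y s.1 * y s.2)).
  under [RHS]eq_bigr => i _ do rewrite exchange_big /=.
  rewrite [RHS]exchange_big; apply: eq_bigr => s _; rewrite /A mulr_suml.
  by apply: eq_bigr => i _; rewrite mulr_suml.
apply: eq_bigr => i _; rewrite (@lin_sum _ _ K^o l) //; apply: eq_bigr => j _.
rewrite (@linZ _ _ K^o l) // (@linZ _ _ K^o l) //.
rewrite !xE [RHS](_ : _ = nuc i j * ((\sum_p mult i k p * y p) *
  (\sum_r mult j k' r * y r))); last by congr (_ * _); exact: mulrC.
rewrite mulr_suml mulr_sumr -(pair_bigA _ (fun p r =>
  nuc i j * (mult i k p * mult j k' r) * (y p * y r))) /=.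
apply: eq_bigr => p _; rewrite !mulr_sumr; apply: eq_bigr => r _.
by rewrite -!mulrA; congr (_ * (_ * _)); rewrite mulrCA.
Qed.

Theorem corollary4 (K : closedFieldType) (charK : [pchar K] =i pred0)
    (H : falgType K) (S : hopf_structure H) (ssH : semisimple_algebra H) :
  (exists (L : fieldExtType rat) (iota : {rmorphism L -> K}) (HR : H -> Prop),
     weak_form S (number_ring iota) HR) ->
  frobenius_type H.
Proof.
move=> [L [iota [HR [x [bx _ [mult Rmult multE] nuE]]]]] V rho [[rho1 rhoM] V0 irr].
have [Lam [intL epsL _]] := unimodular S ssH.
pose N : H := (\dim {:H})%:R *: Lam.
have intN : integral S N.
  move=> h; have [lL rL] := intL h.
  by rewrite -scalerAr -scalerAl lL rL !scalerA mulrC.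
have epsN : counit S N = (\dim {:H})%:R by rewrite linearZ /= epsL mulr1.
have [nuc Rnuc nucE] := nuE N (conj intN epsN).
apply: (@frobenius_divisibility K charK H S V (fun h => rho h) N (\dim {:H})
  'I_(\dim {:H}) (fun i => x`_i) mult nuc).
- by move=> u a h k; rewrite linearP !lfunE /= lfunE.
- by move=> h; exact: linearP.
- by move=> u; rewrite rho1 lfunE.
- by move=> h k u; rewrite rhoM comp_lfunE.
- move=> U Uact; apply: irr => h; apply/subvP => _ /memv_imgP[u Uu ->].
  exact: Uact.
- exact: V0.
- exact: (square_antipode charK S ssH).
- by move=> h; have [] := intN h.
- exact: epsN.
- move=> h; exists (fun i => coord x i h); rewrite {1}(coord_basis bx (memvf h)).
  by apply: eq_bigr.
- by move=> i j l; have [] := Rmult i j l.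
- exact: multE.
- by move=> i j; have [] := Rnuc i j.
exact: nucE.
Qed.
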